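(* Let $m\ge 2$ and let $\pi=\mathbb{R}^m\times\{0\}\subset\mathbb{R}^{m+1}$, with $B_1\subset\pi$ the open unit ball centered at $0$. There exists a smooth, radially symmetric function $f:B_1\to\mathbb{R}$ such that the integral current $T=\mathbf{G}_f$ given by the graph of $f$ is semicalibrated (by some form $\omega$ in $B_1\times\mathbb{R}$) and its intrinsic planar frequency function relative to $\pi$ at the origin satisfies $$N_{T,\pi,0}(r)\longrightarrow+\infty\qquad\text{as } r\downarrow 0 .$$
   Context: A semicalibration is a $C^1$ $m$-form $\omega$ with comass at most $1$ at every point; a current $T$ is semicalibrated by $\omega$ if $\omega(\vec T)=1$ at $\|T\|$-a.e. point, where $\vec T$ is the orienting unit $m$-vector and $\|T\|$ the mass measure. $\mathbf{G}_f$ is the multiplicity-one current associated with $\{(x,f(x)):x\in B_1\}$, with orientation for which it is semicalibrated by $\omega$. Let $\phi:[0,\infty)\to[0,1]$ be $\phi(t)=1$ for $0\le t\le\frac12$, $\phi(t)=2-2t$ for $\frac12\le t\le1$, and $\phi(t)=0$ otherwise. Let $\mathbf{p}_\pi$ and $\mathbf{p}_{\pi^\perp}$ be the orthogonal projections onto $\pi$ and $\pi^\perp$, let $\mathbf{p}_T(p)$ be the orthogonal projection onto the tangent plane of $T$ at $p$, and let $\nabla_{\vec T}g$ be the projection of $\nabla g$ to the tangent plane of $T$. For $r\in(0,1)$ define $$H_{T,\pi,0}(r)=-\frac1{r^{m-1}}\int \operatorname{dist}^2(p,\pi)\,\frac{|\nabla_{\vec T}|\mathbf{p}_\pi(p)||^2}{|\mathbf{p}_\pi(p)|}\,\phi'\!\left(\frac{|\mathbf{p}_\pi(p)|}{r}\right)d\|T\|(p),$$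 $$D_{T,\pi,0}(r)=\frac1{2r^{m-2}}\int|\mathbf{p}_T(p)-\mathbf{p}_\pi|^2\,\phi\!\left(\frac{|\mathbf{p}_\pi(p)|}{r}\right)d\|T\|(p)$$ (with $|\cdot|$ the Hilbert–Schmidt norm on matrices), $$L_{T,\pi,0}(r)=\frac1{2r^{m-2}}\int\big\langle d\omega\llcorner\mathbf{p}_{\pi^\perp}(p),\vec T(p)\big\rangle\,\phi\!\left(\frac{|\mathbf{p}_\pi(p)|}{r}\right)d\|T\|(p),$$ where $\langle d\omega\llcorner X,\vec T\rangle=\langle d\omega,X\wedge\vec T\rangle$. Set $\Gamma_{T,\pi,0}=D_{T,\pi,0}+L_{T,\pi,0}$ and, whenever $H_{T,\pi,0}(r)>0$, $$N_{T,\pi,0}(r)=\frac{\Gamma_{T,\pi,0}(r)}{H_{T,\pi,0}(r)} .$$ The claimed limit includes that $H_{T,\pi,0}(r)>0$ for all small $r>0$. *)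

(* Defs.v *)
From HB Require Import structures.
From mathcomp Require Import all_boot all_order all_algebra.
From mathcomp Require Import all_classical all_reals all_analysis.

Set Implicit Arguments.
Unset Strict Implicit.
Unset Printing Implicit Defensive.

Import Order.TTheory GRing.Theory Num.Theory.
Import numFieldNormedType.Exports.

Local Open Scope classical_set_scope.
Local Open Scope ring_scope.

Definition matrix_display : measure_display. Proof. exact. Qed.

(* The sigma-algebra generated by the entries, which is the Borel one. *)
Section measurable_matrix.
Context {R : realType} {m n : nat}.

Definition matrix_cylinders : set (set 'M[R]_(m, n)) :=
  [set X | exists i j (B : set R),
    measurable B /\ X = [set A : 'M[R]_(m, n) | B (A i j)]].

Let matrix_set0 : <<s matrix_cylinders >> set0.
Proof. exact: sigma_algebra0. Qed.

Let matrix_setC X : <<s matrix_cylinders >> X -> <<s matrix_cylinders >> (~` X).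
Proof. exact: sigma_algebraC. Qed.

Let matrix_bigcup (F : (set 'M[R]_(m, n))^nat) :
  (forall i, <<s matrix_cylinders >> (F i)) ->
  <<s matrix_cylinders >> (\bigcup_i (F i)).
Proof. exact: sigma_algebra_bigcup. Qed.

HB.instance Definition _ := @isMeasurable.Build matrix_display
  'M[R]_(m, n) <<s matrix_cylinders >> matrix_set0 matrix_setC matrix_bigcup.

End measurable_matrix.

Lemma measurable_entry (R : realType) m n (i : 'I_m) (j : 'I_n) :
  measurable_fun setT (fun A : 'M[R]_(m, n) => A i j).
Proof.
move=> _ B mB; rewrite setTI; apply: sub_sigma_algebra.
by exists i, j, B.
Qed.

Lemma measurable_fun_matrixP d (T : measurableType d) (R : realType) m n
    (g : T -> 'M[R]_(m, n)) :
  measurable_fun setT g <-> forall i j, measurable_fun setT (fun t => g t i j).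
Proof.
split=> [mg i j|mg].
  exact: (measurableT_comp (measurable_entry i j) mg).
apply: (@measurability _ _ _ _ _ _ (@matrix_cylinders R m n)) => //.
move=> _ [_ [i [j [B [mB ->]]]] <-].
exact: mg.
Qed.

Section lebesgue_cons.
Context {R : realType} {n : nat}.

Definition rV_cons (p : R * 'rV[R]_n) : 'rV[R]_n.+1 :=
  row_mx (p.1)%:M p.2 : 'rV[R]_(1 + n).

Let rV_uncons (x : 'rV[R]_n.+1) : R * 'rV[R]_n :=
  (x 0 0, \row_j x 0 (lift ord0 j)).

Let rV_consK : cancel rV_cons rV_uncons.
Proof.
move=> [a x]; rewrite /rV_uncons /rV_cons /=; congr pair.
  have -> : 0 = lshift n 0 :> 'I_(1 + n) by exact: val_inj.
  by apply: etrans (row_mxEl a%:M x 0 0) _; rewrite mxE eqxx mulr1n.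
apply/rowP => j; rewrite mxE.
have -> : lift ord0 j = rshift 1 j :> 'I_(1 + n) by exact: val_inj.
exact: (row_mxEr a%:M x 0 j).
Qed.

Lemma measurable_rV_cons : measurable_fun setT rV_cons.
Proof.
apply/measurable_fun_matrixP => i j.
rewrite ord1 -(@splitK 1 n j); case: (fintype.split _) => k /=.
  rewrite (_ : (fun _ => _) = fst); first exact: measurable_fst.
  apply/funext => p; apply: etrans (row_mxEl (p.1)%:M p.2 0 k) _.
  by rewrite mxE ord1 eqxx mulr1n.
rewrite (_ : (fun _ => _) = (fun A : 'rV[R]_n => A 0 k) \o snd).
  by apply: measurableT_comp; [exact: measurable_entry|exact: measurable_snd].
by apply/funext => p; exact: (row_mxEr (p.1)%:M p.2 0 k).
Qed.

Let measurable_rV_uncons : measurable_fun setT rV_uncons.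
Proof.
apply/measurable_fun_pair; first exact: measurable_entry.
apply/measurable_fun_matrixP => i j; rewrite (_ : (fun _ => _) =
  (fun A : 'rV[R]_n.+1 => A 0 (lift ord0 j))); first exact: measurable_entry.
by apply/funext => x; rewrite mxE.
Qed.

Variable mu : {sigma_finite_measure set 'rV[R]_n -> \bar R}.

Definition lebesgue_cons : set 'rV[R]_n.+1 -> \bar R :=
  pushforward (@lebesgue_measure R \x mu)%E rV_cons.

Let lebesgue_cons0 : lebesgue_cons set0 = 0%E.
Proof. by rewrite /lebesgue_cons /pushforward preimage_set0 measure0. Qed.

Let lebesgue_cons_ge0 A : (0 <= lebesgue_cons A)%E.
Proof. by apply: integral_ge0 => a _; exact: measure_ge0. Qed.

Let lebesgue_cons_sigma_additive : semi_sigma_additive lebesgue_cons.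
Proof.
have mc A : measurable A -> measurable (rV_cons @^-1` A).
  by move=> mA; rewrite -[X in measurable X]setTI; exact: measurable_rV_cons.
move=> F mF tF mUF; rewrite /lebesgue_cons /pushforward preimage_bigcup.
apply: (@measure_semi_sigma_additive _ _ _ (@lebesgue_measure R \x mu)%E).
- by move=> i; exact: mc.
- apply/trivIsetP => /= i j _ _ ij; rewrite -preimage_setI.
  by move/trivIsetP : tF => /(_ _ _ _ _ ij) ->//; rewrite preimage_set0.
- by rewrite -preimage_bigcup; exact: mc.
Qed.

HB.instance Definition _ := isMeasure.Build _ _ _ lebesgue_cons
  lebesgue_cons0 lebesgue_cons_ge0 lebesgue_cons_sigma_additive.

Let lebesgue_cons_sigma_finite : sigma_finite setT lebesgue_cons.
Proof.
have /sigma_finiteP[F [TF ndF Foo]] := sigma_finiteT (@lebesgue_measure R).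
have /sigma_finiteP[G [TG ndG Goo]] := sigma_finiteT mu.
exists (fun i => rV_uncons @^-1` (F i `*` G i)).
  rewrite -preimage_bigcup (_ : \bigcup_i _ = setT) ?preimage_setT //.
  rewrite -subTset => -[a x] _.
  have [k _ Fa] : (\bigcup_i F i) a by rewrite -TF.
  have [l _ Gx] : (\bigcup_i G i) x by rewrite -TG.
  exists (maxn k l) => //; split.
    by move: a Fa; exact/subsetPset/ndF/leq_maxl.
  by move: x Gx; exact/subsetPset/ndG/leq_maxr.
move=> i; have [mF Fi] := Foo i; have [mG Gi] := Goo i; split.
  by rewrite -[X in measurable X]setTI; apply: measurable_rV_uncons => //;
    exact: measurableX.
rewrite /lebesgue_cons /pushforward -comp_preimage.
rewrite (_ : rV_uncons \o rV_cons = id) ?preimage_id; last first.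
  by apply/funext => p /=; exact: rV_consK.
by rewrite product_measure1E // lte_mul_pinfty // ge0_fin_numE.
Qed.

HB.instance Definition _ := Measure_isSigmaFinite.Build _ _ _ lebesgue_cons
  lebesgue_cons_sigma_finite.

End lebesgue_cons.

(* Lebesgue measure on R^n, as an iterated product of the one on R. *)
Fixpoint lebesgue_rV (R : realType) n :
    {sigma_finite_measure set 'rV[R]_n -> \bar R} :=
  match n with
  | 0 => [the sigma_finite_measure _ _ of dirac (0 : 'rV[R]_0)]
  | n'.+1 => [the sigma_finite_measure _ _ of lebesgue_cons (lebesgue_rV R n')]
  end.

Section definitions.
Context {R : realType}.

(* The library norm on matrices is the sup norm; this is the Hilbert-Schmidt
   norm, i.e. the Euclidean norm on row vectors. *)
Definition hsnorm m n (A : 'M[R]_(m, n)) : R :=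
  Num.sqrt (\sum_i \sum_j A i j ^+ 2).

(* Planes are given as row spaces, and vectors are rows, so that linear maps act
   by right multiplication.  If the rows of [A] are independent, this is the
   orthogonal projection onto their span. *)
Definition orthproj m n (A : 'M[R]_(m, n)) : 'M[R]_n :=
  A^T *m invmx (A *m A^T) *m A.

Definition dist_plane m n (P : 'M[R]_(m, n)) (p : 'rV[R]_n) : R :=
  inf [set hsnorm (p - q) | q in [set q : 'rV[R]_n | (q <= P)%MS]].

Definition gradient n (g : 'rV[R]_n -> R) (p : 'rV[R]_n) : 'rV[R]_n :=
  \row_j 'D_(delta_mx 0 j) g p.

(* A simple m-vector [v_1 /\ ... /\ v_m] of R^n is represented by the matrix with
   rows [v_1, ..., v_m], and an m-covector by its values on such matrices, so that
   the pairing is application. *)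
Definition mcovector m n (alpha : 'M[R]_(m, n) -> R) : Prop :=
  (forall (A B C : 'M[R]_(m, n)) i (b c : R),
     row i A = b *: row i B + c *: row i C ->
     row' i B = row' i A -> row' i C = row' i A ->
     alpha A = b * alpha B + c * alpha C) /\
  (forall (A : 'M[R]_(m, n)) i j,
     i != j -> row i A = row j A -> alpha A = 0).

(* The Euclidean norm of [v_1 /\ ... /\ v_m], by the Gram determinant. *)
Definition mvnorm m n (A : 'M[R]_(m, n)) : R := Num.sqrt (\det (A *m A^T)).

Definition comass m n (alpha : 'M[R]_(m, n) -> R) : \bar R :=
  ereal_sup [set (alpha A)%:E | A in [set A | mvnorm A = 1]].

Definition mform m n := 'rV[R]_n -> 'M[R]_(m, n) -> R.

Fixpoint Ck n (k : nat) (U : set 'rV[R]_n) (g : 'rV[R]_n -> R) : Prop :=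
  match k with
  | 0 => forall p, U p -> {for p, continuous g}
  | k'.+1 => (forall p, U p -> differentiable g p) /\
             forall v, Ck k' U ('D_v g)
  end.

Definition smooth n (U : set 'rV[R]_n) (g : 'rV[R]_n -> R) : Prop :=
  forall k, Ck k U g.

Definition form_Ck m n (k : nat) (U : set 'rV[R]_n) (omega : mform m n) : Prop :=
  (forall p, U p -> mcovector (omega p)) /\
  (forall A, Ck k U (fun p => omega p A)).

Definition test_form m n (U : set 'rV[R]_n) (eta : mform m n) : Prop :=
  (forall k, form_Ck k setT eta) /\
  exists K, [/\ compact K, K `<=` U & forall p A, ~ K p -> eta p A = 0].

(* [d omega (v_0, ..., v_m) = \sum_i (-1)^i D_(v_i) omega (v_0, .^., v_m)] *)
Definition extd m n (omega : mform m n) : mform m.+1 n :=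
  fun p A => \sum_(i < m.+1)
    (-1) ^+ i * 'D_(row i A) (fun q => omega q (row' i A)) p.

(* [<beta |_ X, v_1 /\ ... /\ v_m> = <beta, X /\ v_1 /\ ... /\ v_m>] *)
Definition contract m n (beta : 'M[R]_(m.+1, n) -> R) (X : 'rV[R]_n) :
    'M[R]_(m, n) -> R :=
  fun A => beta (col_mx X A : 'M[R]_(1 + m, n)).

Definition semicalibration m n (U : set 'rV[R]_n) (omega : mform m n) : Prop :=
  form_Ck 1 U omega /\ forall p, U p -> (comass (omega p) <= 1)%E.

(* An m-current of finite mass in the open set [U] with simple orientation, given
   by its mass measure (carried by [U]) and its orienting unit m-vector. *)
Record current m n (U : set 'rV[R]_n) := Current {
  mass : {finite_measure set 'rV[R]_n -> \bar R};
  orient : 'rV[R]_n -> 'M[R]_(m, n);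
  mass_outside : mass (~` U) = 0%E;
  measurable_orient : measurable_fun setT orient;
  orient_unit : {ae mass, forall p, mvnorm (orient p) = 1} }.

Section frequency.
Context {m n : nat} {U : set 'rV[R]_n}.
Implicit Types (T : current m U) (omega : mform m n).

(* The action of [T] on test forms determines [mass T], and [orient T p] as a
   unit m-vector at almost every [p]. *)
Definition evaluate T (eta : mform m n) : R :=
  \int[mass T]_p eta p (orient T p).

Definition semicalibrated T omega : Prop :=
  {ae mass T, forall p, omega p (orient T p) = 1}.

Definition tangent_proj T (p : 'rV[R]_n) : 'M[R]_n := orthproj (orient T p).

Definition tangent_gradient T (g : 'rV[R]_n -> R) (p : 'rV[R]_n) : 'rV[R]_n :=
  gradient g p *m tangent_proj T p.

(* Only used for [0 <= t]. *)
Definition phi (t : R) : R :=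
  if t <= 2^-1 then 1 else if t <= 1 then 2 - 2 * t else 0.

Variable P : 'M[R]_(m, n).

Definition proj_norm (p : 'rV[R]_n) : R := hsnorm (p *m orthproj P).

(* [derive1] is the library derivative, with an arbitrary value at the kinks of
   [phi]; these are reached only on a null set. *)
Definition freqH T (r : R) : R :=
  - (r ^- (m - 1) *
     \int[mass T]_p (dist_plane P p ^+ 2 *
       (hsnorm (tangent_gradient T proj_norm p) ^+ 2 / proj_norm p) *
       derive1 phi (proj_norm p / r))).

Definition freqD T (r : R) : R :=
  (2 * r ^+ (m - 2))^-1 *
  \int[mass T]_p
    (hsnorm (tangent_proj T p - orthproj P) ^+ 2 * phi (proj_norm p / r)).

Definition freqL T omega (r : R) : R :=
  (2 * r ^+ (m - 2))^-1 *
  \int[mass T]_p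
    (contract (extd omega p) (p *m (1%:M - orthproj P)) (orient T p) *
     phi (proj_norm p / r)).

Definition freqGamma T omega (r : R) : R := freqD T r + freqL T omega r.

Definition freqN T omega (r : R) : R := freqGamma T omega r / freqH T r.

End frequency.

Definition unit_ball m : set 'rV[R]_m := [set x | hsnorm x < 1].

Definition cylinder m : set 'rV[R]_(m + 1) := [set p | unit_ball (lsubmx p)].

Definition base_plane m : 'M[R]_(m, m + 1) := row_mx 1%:M 0.

Definition graph_map m (f : 'rV[R]_m -> R) (x : 'rV[R]_m) : 'rV[R]_(m + 1) :=
  row_mx x (f x)%:M.

(* The rows of the Jacobian matrix are the partial derivatives of the graph map;
   [s] selects one of the two orientations. *)
Definition is_graph_current m (f : 'rV[R]_m -> R)
    (T : current m (@cylinder m)) : Prop :=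
  exists s : bool, forall eta, test_form (@cylinder m) eta ->
    evaluate T eta = (-1) ^+ s *
      \int[lebesgue_rV R m]_(x in @unit_ball m)
        eta (graph_map f x) ('J (graph_map f) x).

Definition radial m (f : 'rV[R]_m -> R) : Prop :=
  forall x y, unit_ball x -> unit_ball y -> hsnorm x = hsnorm y -> f x = f y.

End definitions.

(* Main.v *)
From HB Require Import structures.
Require Import Defs.
From mathcomp Require Import all_boot all_order all_algebra.
From mathcomp Require Import all_classical all_reals all_analysis.
From mathcomp Require Import measurable_realfun.
From mathcomp Require Import ring lra.
Import numFieldNormedType.Exports.
Import Order.TTheory GRing.Theory Num.Theory.

Set Implicit Arguments.
Unset Strict Implicit.
Unset Printing Implicit Defensive.

Local Open Scope classical_set_scope.
Local Open Scope ring_scope.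

(** Take f(x) = exp(- 1 / |x|^2), which vanishes to infinite order at the
origin, and let nu = (- grad f, 1) / sqrt (1 + |grad f|^2) be the unit normal
of its graph, extended to the cylinder independently of the vertical variable.
The m-form omega(v_1, ..., v_m) = det(v_1, ..., v_m, nu) has comass at most 1
by the Hadamard-Fischer inequality [det_col_mx_le] and is equal to 1 on the unit
tangent m-vector of the graph, so it semicalibrates the graph.  Moreover
d omega (X, v_1, ..., v_m) = div(nu) det(v_1, ..., v_m, X) [extd_calib], because
the derivative of the determinant in the direction of an endomorphism is the
trace of the latter [trace_det_sum].

Write t = |x|^2, s = |x|, and tau = 1 / sqrt (1 + |grad f|^2) (the function
[tilt]).  Over the ball, the integrand of 2 r^(m-2) (D + L) is
  (2 (1 - tau^2) / tau + f div(nu)) phi(s / r),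
and that of r^(m-1) H is 2 f^2 tau / s on the annulus r/2 < s < r.  To leading
order as s -> 0 the factor of phi is 2 |grad f|^2 - f f'', with f' = 2 s^-3 f
and f'' = 4 s^-6 f + ..., hence about 4 s^-6 f^2.  So it is bounded below
pointwise by 2 s^-6 f^2 tau [integrand_ge], and r^(m-2) (D + L) is at least the
energy J(r), the integral of s^-6 f^2 tau phi(s / r).

It remains to bound H by J, although phi vanishes at s = r, where f is
largest.  Replace x by l x in the integral for H, where l = 1 + r^2.  This
dilation costs a bounded factor, since it changes 1 / |x|^2 by a bounded amount
when |x| is comparable to r, while it moves the annulus to
r / (2 l) < s < r / l, where phi is at least r^2.  There
f^2 / (l s) <= 2 r^5 s^-6 f^2 <= 2 r^3 s^-6 f^2 phi, which gives
r^(m-1) H <= C r^3 J [scaled_integrand_le, height_le_energy].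
Hence N = (D + L) / H >= c / r^2, which tends to infinity.

The facts on Lebesgue measure that enter are its behaviour under dilations
[integral_scale_rV] and the volume of cubes [lebesgue_cube]. *)

(** * Determinants and projections for hyperplanes *)
Section LinearAlgebra.
Context {R : realType}.

Definition nsq n (x : 'rV[R]_n) : R := \sum_j x 0 j ^+ 2.

Lemma nsq_ge0 n (x : 'rV[R]_n) : 0 <= nsq x.
Proof. by apply: sumr_ge0 => j _; rewrite sqr_ge0. Qed.

Lemma nsq0 n : nsq (0 : 'rV[R]_n) = 0.
Proof. by rewrite /nsq big1 // => j _; rewrite mxE expr0n. Qed.

Lemma nsq_mul n (x : 'rV[R]_n) : x *m x^T = (nsq x)%:M.
Proof.
apply/matrixP => i j; rewrite !mxE !ord1 eqxx mulr1n.
by apply: eq_bigr => k _; rewrite !mxE expr2.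
Qed.

Lemma nsqZ n a (x : 'rV[R]_n) : nsq (a *: x) = a ^+ 2 * nsq x.
Proof. by rewrite mulr_sumr; apply: eq_bigr => j _; rewrite mxE exprMn. Qed.

Lemma nsq_row_mx n1 n2 (x : 'rV[R]_n1) (y : 'rV[R]_n2) :
  nsq (row_mx x y) = nsq x + nsq y.
Proof.
rewrite /nsq big_split_ord /=; congr (_ + _); apply: eq_bigr => j _.
  by rewrite row_mxEl.
by rewrite row_mxEr.
Qed.

Lemma nsq_scalar (a : R) : nsq a%:M = a ^+ 2.
Proof. by rewrite /nsq big_ord_recl big_ord0 addr0 mxE eqxx mulr1n. Qed.

Lemma hsnorm_row n (x : 'rV[R]_n) : hsnorm x = Num.sqrt (nsq x).
Proof. by rewrite /hsnorm big_ord_recl big_ord0 addr0. Qed.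

Lemma hsnorm_sqr_row n (x : 'rV[R]_n) : hsnorm x ^+ 2 = nsq x.
Proof. by rewrite hsnorm_row sqr_sqrtr ?nsq_ge0. Qed.

(** If v is orthogonal to the rows of A, adding v as a row makes the Gram
matrix block diagonal; this is the source of all the Gram determinants
below. *)
Lemma gram_col_mx m n (A : 'M[R]_(m, n)) (v : 'rV[R]_n) : A *m v^T = 0 ->
  col_mx A v *m (col_mx A v)^T = block_mx (A *m A^T) 0 0 (nsq v)%:M.
Proof.
move=> Av; rewrite tr_col_mx mul_col_row Av nsq_mul.
by rewrite -[v *m A^T]trmxK trmx_mul trmxK Av trmx0.
Qed.

Lemma det_col_mx_orth m (A : 'M[R]_(m, m + 1)) (v : 'rV[R]_(m + 1)) :
  A *m v^T = 0 ->
  \det (col_mx A v) ^+ 2 = \det (A *m A^T) * nsq v.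
Proof.
move=> Av; rewrite expr2 -{2}det_tr -det_mulmx gram_col_mx // det_lblock.
by rewrite det_scalar1.
Qed.

Lemma orthprojT m n (A : 'M[R]_(m, n)) : (orthproj A)^T = orthproj A.
Proof.
by rewrite /orthproj !trmx_mul trmx_inv trmx_mul !trmxK mulmxA.
Qed.

Lemma mul_orthproj m n (A : 'M[R]_(m, n)) : A *m A^T \in unitmx ->
  A *m orthproj A = A.
Proof. by move=> uA; rewrite /orthproj !mulmxA mulmxV // mul1mx. Qed.

Lemma orthproj_idem m n (A : 'M[R]_(m, n)) : A *m A^T \in unitmx ->
  orthproj A *m orthproj A = orthproj A.
Proof. by move=> uA; rewrite {1}/orthproj -mulmxA mul_orthproj. Qed.

(** Pythagoras: [orthproj A] is a symmetric idempotent. *)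
Lemma nsq_orthproj m n (A : 'M[R]_(m, n)) (v : 'rV[R]_n) :
  A *m A^T \in unitmx -> nsq v = nsq (v - v *m orthproj A) + nsq (v *m orthproj A).
Proof.
move=> uA; set Q := orthproj A; set w := v *m Q.
have wv : w *m v^T = (nsq w)%:M.
  rewrite -nsq_mul {3}/w trmx_mul orthprojT mulmxA; congr (_ *m _).
  by rewrite /w -mulmxA orthproj_idem.
have vw : v *m w^T = (nsq w)%:M by rewrite -wv -[LHS]trmxK trmx_mul trmxK wv tr_scalar_mx.
have /(congr1 (fun M : 'M[R]_1 => M 0 0)) : (nsq v)%:M =
    (nsq (v - w) + nsq w)%:M :> 'M[R]_1.
  rewrite raddfD /= -!nsq_mul linearB /= mulmxBl !mulmxBr wv vw !nsq_mul.
  by rewrite subrr subr0 subrK.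
by rewrite !mxE eqxx !mulr1n.
Qed.

(** Hadamard-Fischer inequality: subtracting from v its projection onto the
rows of A does not change the determinant, and shortens v. *)
Lemma det_col_mx_le m (A : 'M[R]_(m, m + 1)) (v : 'rV[R]_(m + 1)) :
  0 < \det (A *m A^T) ->
  \det (col_mx A v) ^+ 2 <= \det (A *m A^T) * nsq v.
Proof.
move=> dA; have uA : A *m A^T \in unitmx by rewrite unitmxE unitfE gt_eqF.
set w := v - v *m orthproj A.
have Aw : A *m w^T = 0.
  by rewrite linearB /= trmx_mul orthprojT mulmxBr mulmxA mul_orthproj // subrr.
have -> : \det (col_mx A v) = \det (col_mx A w).
  have -> : col_mx A w =
    block_mx 1%:M 0 (- (v *m A^T *m invmx (A *m A^T))) 1%:M *m col_mx A v.
    rewrite mul_block_col !mul1mx mul0mx addr0 mulNmx addrC; congr (col_mx _ (_ - _)).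
    by rewrite /orthproj !mulmxA.
  by rewrite det_mulmx det_lblock !det1 !mul1r.
rewrite det_col_mx_orth // ler_wpM2l ?(ltW dA) //.
by rewrite (nsq_orthproj v uA) lerDl nsq_ge0.
Qed.

(** Both sides agree after multiplication by the invertible matrix whose rows
are those of A and the normal v. *)
Lemma orthproj_hyperplane m (A : 'M[R]_(m, m + 1)) (v : 'rV[R]_(m + 1)) :
  A *m A^T \in unitmx -> A *m v^T = 0 -> nsq v = 1 ->
  orthproj A = 1%:M - v^T *m v.
Proof.
move=> uA Av v1.
have uV : col_mx A v \in unitmx.
  rewrite unitmxE unitfE -sqrf_eq0 det_col_mx_orth // v1 mulr1.
  by move: uA; rewrite unitmxE unitfE.
apply: (can_inj (mulKmx uV)); rewrite !mul_col_mx.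
rewrite mul_orthproj // (mulmxBr A) mulmx1 (mulmxA A) Av mul0mx subr0; congr col_mx.
rewrite [RHS]mulmxBr mulmx1 [X in _ - X]mulmxA nsq_mul v1 mul1mx subrr /orthproj !mulmxA.
by rewrite -[v *m A^T]trmxK trmx_mul trmxK Av trmx0 !mul0mx.
Qed.

(** The normal [(- g, 1)] of the graph of a function with gradient g, scaled
by c. *)
Definition normal_row m (c : R) (g : 'rV[R]_m) : 'rV[R]_(m + 1) :=
  row_mx (- (c *: g)) c%:M.

Lemma nsqN n (x : 'rV[R]_n) : nsq (- x) = nsq x.
Proof. by apply: eq_bigr => j _; rewrite mxE sqrrN. Qed.

Lemma nsq_normal_row m c (g : 'rV[R]_m) : nsq (normal_row c g) = c ^+ 2 * (1 + nsq g).
Proof. by rewrite nsq_row_mx nsqN nsqZ nsq_scalar; ring. Qed.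

Lemma mul_frame_normal m c (g : 'rV[R]_m) (D : 'M[R]_m) :
  (D *m row_mx 1%:M g^T) *m (normal_row c g)^T = 0.
Proof.
rewrite -mulmxA tr_row_mx mul_row_col mul1mx linearN /= linearZ /= tr_scalar_mx.
by rewrite mul_mx_scalar addNr mulmx0.
Qed.

(** The matrix D only rescales the frame: it is used to normalise the tangent
frame [(1 | g^T)] of a graph. *)
Lemma det_frame_normal m c (g : 'rV[R]_m) (D : 'M[R]_m) :
  \det (col_mx (D *m row_mx 1%:M g^T) (normal_row c g)) =
  \det D * (c * (1 + nsq g)).
Proof.
have -> : col_mx (D *m row_mx 1%:M g^T) (normal_row c g) =
  block_mx D 0 0 1%:M *m (block_mx 1%:M 0 (- (c *: g)) 1%:M *m
   block_mx 1%:M g^T 0 (c * (1 + nsq g))%:M).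
  rewrite mulmx_block mul0mx mul1mx mulmx0 mulmx1 !addr0 mul1mx.
  rewrite mulmx_block !mul0mx !mul1mx !mulmx1 !addr0.
  rewrite mul_mx_row mulmx1 block_mxEv; congr (col_mx _ (row_mx _ _)); first by rewrite add0r.
  rewrite mulNmx -scalemxAl nsq_mul scale_scalar_mx add0r -raddfN -raddfD /=.
  by congr (_ %:M); ring.
by rewrite det_mulmx det_mulmx !det_lblock det_ublock !det1 det_scalar1 !mul1r !mulr1.
Qed.

(** The coefficients of [\det (col_mx B u)] as a linear function of u; the last
row of the matrix does not enter these cofactors, and is set to zero. *)
Definition last_cofactor m (B : 'M[R]_(m, m + 1)) (j : 'I_(m + 1)) : R :=
  cofactor (col_mx B 0) (rshift m 0) j.

Lemma det_col_mx_sum m (B : 'M[R]_(m, m + 1)) (u : 'rV[R]_(m + 1)) :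
  \det (col_mx B u) = \sum_j u 0 j * last_cofactor B j.
Proof.
rewrite (expand_det_row _ (rshift m 0)); apply: eq_bigr => j _.
rewrite col_mxEd /last_cofactor /cofactor; congr (_ * (_ * \det _)).
apply/matrixP => k l; rewrite !mxE; case: splitP => // k'; rewrite ord1 /= => e.
have := neq_lift (rshift m (0 : 'I_1)) k; rewrite -(inj_eq val_inj) /=.
by rewrite e eqxx.
Qed.

(** Moving row i of a square matrix W to the bottom costs the sign
[(-1) ^+ (m - i)].  The cast is needed because m.+1 and m + 1 are different
expressions. *)
Lemma last_cofactor_row' m (e : m.+1 = (m + 1)%N) (W : 'M[R]_(m.+1, m + 1))
    (i : 'I_m.+1) j :
  (-1) ^+ i * last_cofactor (row' i W) j =
  (-1) ^+ m * cofactor (castmx (e, erefl) W) (cast_ord e i) j.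
Proof.
rewrite /last_cofactor /cofactor /= addn0 !exprD.
set d1 := \det _; set d2 := \det _; suff -> : d1 = d2.
  by rewrite -!mulrA [RHS]mulrCA.
rewrite {}/d1 {}/d2; congr (\det _).
have e' : (m + 1).-1 = m by rewrite addn1.
have km (k : 'I_(m + 1).-1) : (k < m)%N by case: k => k /=; rewrite {1}addn1.
apply/matrixP => k l; rewrite !mxE castmxE /= cast_ord_id.
have -> : lift (rshift m (0 : 'I_1)) k = lshift 1 (cast_ord e' k).
  by apply: val_inj; rewrite /= /bump addn0 leqNgt km.
case: splitP => [k' /= ek|k' /= ek]; last first.
  by have := km k; rewrite ek ltnNge leq_addr.
rewrite mxE; congr (W _ _); apply: val_inj => /=.
by rewrite -ek.
Qed.

(** Jacobi formula.  By [last_cofactor_row'] the sum is, up to sign,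
[\tr (W *m N *m \adj W)], that is [\tr N * \det W]; and moving X from the first
row to the last one cancels the sign.  The left-hand side is the shape taken by
the exterior derivative of v_1, ..., v_m |-> det(v_1, ..., v_m, nu). *)
Lemma trace_det_sum m (X : 'rV[R]_(m + 1)) (A : 'M[R]_(m, m + 1)) (N : 'M[R]_(m + 1)) :
  let W := col_mx X A : 'M[R]_(m.+1, m + 1) in
  \sum_(i < m.+1) (-1) ^+ i * \det (col_mx (row' i W) (row i W *m N)) =
  \tr N * \det (col_mx A X).
Proof.
move=> W; have e : m.+1 = (m + 1)%N by rewrite addn1.
pose V := castmx (e, erefl (m + 1)%N) W.
have WV i j : W i j = V (cast_ord e i) j.
  by rewrite castmxE /= cast_ordK cast_ord_id.
have dV : \det V = (-1) ^+ m * \det (col_mx A X).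
  rewrite (expand_det_row _ (cast_ord e ord0)) det_col_mx_sum mulr_sumr.
  apply: eq_bigr => j _.
  have := last_cofactor_row' e W ord0 j; rewrite expr0 mul1r -/V => h.
  have -> : A = row' ord0 W.
    apply/matrixP => k l; rewrite mxE.
    have -> : lift ord0 k = rshift 1 k by apply: val_inj.
    by rewrite (col_mxEd X A k l).
  rewrite [RHS]mulrCA h signrMK; congr (_ * _).
  rewrite -WV; have -> : ord0 = lshift m (0 : 'I_1) by apply: val_inj.
  by rewrite (col_mxEu X A).
have {}dV : \det (col_mx A X) = (-1) ^+ m * \det V by rewrite dV signrMK.
rewrite dV mulrCA; transitivity ((-1) ^+ m * \tr (V *m N *m \adj V)); last first.
  by rewrite -mulmxA mxtrace_mulC -mulmxA mul_adj_mx mul_mx_scalar mxtraceZ [\det V * _]mulrC.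
rewrite /mxtrace mulr_sumr (reindex (cast_ord e)) /=; last first.
  by apply: onW_bij; exists (cast_ord (esym e)) => i; rewrite ?cast_ordK ?cast_ordKV.
apply: eq_bigr => i _; rewrite mxE det_col_mx_sum !mulr_sumr; apply: eq_bigr => j _.
rewrite mulrCA last_cofactor_row' mulrCA; congr (_ * (_ * _)); last by rewrite mxE.
by rewrite !mxE; apply: eq_bigr => k _; rewrite -WV mxE.
Qed.
End LinearAlgebra.

(** * Flat functions and the smooth functions that they generate *)
Section FlatFunctions.
Context {R : realType}.

(** The functions t^-i exp(- 1 / t) for t > 0, extended by zero: they are
closed under differentiation, up to linear combinations. *)
Definition flat (i : nat) (t : R) : R :=
  if 0 < t then t^-1 ^+ i * expR (- t^-1) else 0.

Lemma flat_pos i t : 0 < t -> flat i t = t^-1 ^+ i * expR (- t^-1).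
Proof. by rewrite /flat => ->. Qed.

Lemma flat_npos i t : t <= 0 -> flat i t = 0.
Proof. by rewrite /flat leNgt => /negPf ->. Qed.

Lemma flat_ge0 i t : 0 <= flat i t.
Proof.
rewrite /flat; case: ifP => // t0.
by rewrite mulr_ge0 ?expR_ge0 // exprn_ge0 // invr_ge0 ltW.
Qed.

Lemma flat_gt0 i t : 0 < t -> 0 < flat i t.
Proof. by move=> t0; rewrite flat_pos // mulr_gt0 ?expR_gt0 // exprn_gt0 ?invr_gt0. Qed.

Lemma mul_flat i t : t * flat i.+1 t = flat i t.
Proof.
rewrite /flat; case: ifP => t0; last by rewrite mulr0.
by rewrite exprS !mulrA divff ?mul1r // gt_eqF.
Qed.

(** Flatness at the origin: with n = i + k, exp(1 / (n t)) >= 1 / (n t), and the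
n-th power of this is [expR t^-1 >= (n * t) ^- n]. *)
Lemma flat_le i k t : (0 < i + k)%N -> 0 <= t ->
  flat i t <= (i + k)%:R ^+ (i + k) * t ^+ k.
Proof.
move=> ik; rewrite le_eqVlt => /predU1P[<-|t0].
  by rewrite flat_npos // mulr_ge0 // exprn_ge0.
rewrite flat_pos //; set n := (i + k)%N.
have n0 : 0 < n%:R :> R by rewrite ltr0n.
have : t^-1 ^+ n <= n%:R ^+ n * expR (t^-1).
  have -> : t^-1 = n%:R * (t^-1 / n%:R) by rewrite mulrC divfK // gt_eqF.
  rewrite expRM_natl -exprMn lerXn2r // ?nnegrE.
  - by rewrite mulr_ge0 ?(ltW n0) // divr_ge0 ?(ltW n0) // invr_ge0 ltW.
  - by rewrite mulr_ge0 ?(ltW n0) // expR_ge0.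
  - by rewrite ler_pM2l //; apply: le_trans (expR_ge1Dx _); rewrite lerDr.
rewrite exprD expRN => h; rewrite ler_pdivrMr ?expR_gt0 //.
have := ler_wpM2r (exprn_ge0 k (ltW t0)) h.
rewrite -mulrA -exprMn mulVf ?gt_eqF // expr1n mulr1 => /le_trans; apply.
by rewrite mulrAC.
Qed.

Lemma is_derive_mul (V : normedModType R) (f g : V -> R) x v df dg :
  is_derive x v f df -> is_derive x v g dg ->
  is_derive x v (fun y => f y * g y) (f x * dg + g x * df).
Proof. exact: is_deriveM. Qed.

Lemma is_derive_exp (V : normedModType R) (f : V -> R) n x v df :
  is_derive x v f df ->
  is_derive x v (fun y => f y ^+ n) (n%:R * f x ^+ n.-1 * df).
Proof.
move=> h; have -> : (fun y => f y ^+ n) = f ^+ n.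
  by apply/funext => y; elim: n => [//|n IH]; rewrite !exprS IH.
exact: is_deriveX.
Qed.

(** What makes a flat function differentiable at the origin. *)
Lemma is_derive0_quadratic (u : R -> R) C :
  u 0 = 0 -> (forall h, `|u h| <= C * h ^+ 2) -> is_derive (0 : R) 1 u 0.
Proof.
move=> u0 uC.
have cv : (fun h : R => h^-1 *: ((u \o shift 0) (h *: 1) - u 0)) @ 0^' --> (0 : R).
  apply/cvgr0Pnorm_lt => e e0; near=> h.
  rewrite /= u0 subr0 addr0 [h *: 1]mulr1 normrM normfV.
  have h0 : 0 < `|h| by rewrite normr_gt0; near: h; exact: nbhs_dnbhs_neq.
  rewrite mulrC ltr_pdivrMr //; apply: le_lt_trans (uC h) _.
  rewrite -real_normK ?num_real // expr2 mulrA ltr_pM2r //.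
  have C0 : 0 < `|C| + 1 by rewrite ltr_wpDl.
  apply: (@le_lt_trans _ _ ((`|C| + 1) * `|h|)).
    by rewrite ler_pM2r // (le_trans (ler_norm _)) // lerDl.
  rewrite -ltr_pdivlMl // -[h]subr0 distrC; near: h.
  apply: nbhs_dnbhs; apply: (@nbhsx_ballx _ _ _ ((`|C| + 1)^-1 * e)).
  by rewrite mulr_gt0 // invr_gt0.
apply: DeriveDef; first by apply/cvg_ex; exists 0.
exact: cvg_lim.
Unshelve. all: by end_near. Qed.

Lemma is_derive_flat i (t : R) :
  is_derive t 1 (flat i) (flat i.+2 t - i%:R * flat i.+1 t).
Proof.
have [t0|t0|->] := ltgtP t 0.
- rewrite !flat_npos ?ltW // mulr0 subr0.
  apply: (@near_eq_is_derive _ _ _ (cst 0)) => //.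
  near=> s; rewrite flat_npos //.
  by near: s; exact: lt_le_nbhsl.
- rewrite !flat_pos //.
  apply: (@near_eq_is_derive _ _ _ (fun s : R => s^-1 ^+ i * expR (- s^-1))).
    near=> s; rewrite flat_pos //.
    by near: s; exact: lt_nbhsr.
  have t1 : t != 0 by rewrite gt_eqF.
  have d1 : is_derive t 1 (fun s => s^-1) (- t ^- 2 *: 1 : R).
    exact: (is_deriveV t1 (is_derive_id t 1)).
  have d2 : is_derive t 1 (fun s => expR (- s^-1)) (expR (- t^-1) * (t ^- 2)).
    apply: (@is_derive1_comp _ expR (fun s => - s^-1)).
    by apply: is_derive_eq; rewrite scaleNr opprK [_ *: 1]mulr1.
  apply: is_derive_eq (is_derive_mul (is_derive_exp i d1) d2) _.
  rewrite /GRing.scale /= mulr1 -!exprVn !exprS.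
  by case: i => [|i]; rewrite ?exprS /= ?expr0; ring.
- rewrite !flat_npos // mulr0 subr0.
  apply: (@is_derive0_quadratic _ ((i + 2)%:R ^+ (i + 2))) => [|h].
    by rewrite flat_npos.
  rewrite ger0_norm ?flat_ge0 //.
  have [h0|h0] := leP h 0; last by rewrite flat_le ?addn2 // ltW.
  rewrite flat_npos //; apply: mulr_ge0; [exact: exprn_ge0|exact: sqr_ge0].
Unshelve. all: by end_near. Qed.

(** With t = |x|^2, the gradient of exp(- 1 / |x|^2) is [2 * flat 2 t *: x], so
[tilt t] is the vertical component of the unit normal of the graph, and its
inverse is the area factor. *)
Definition tilt (t : R) : R := (Num.sqrt (1 + 4 * t * flat 2 t ^+ 2))^-1.

Lemma flat_sq_ge0 t : 0 <= t * flat 2 t ^+ 2.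
Proof.
have [t0|t0] := leP t 0; first by rewrite flat_npos // expr0n /= mulr0.
by rewrite mulr_ge0 ?sqr_ge0 // ltW.
Qed.

Lemma tilt_radicand_gt0 t : 0 < 1 + 4 * t * flat 2 t ^+ 2.
Proof. by rewrite ltr_wpDr // -mulrA mulr_ge0 // flat_sq_ge0. Qed.

Lemma tilt_gt0 t : 0 < tilt t.
Proof. by rewrite invr_gt0 sqrtr_gt0 tilt_radicand_gt0. Qed.

Lemma tilt_sq t : tilt t ^+ 2 * (1 + 4 * t * flat 2 t ^+ 2) = 1.
Proof.
have h := tilt_radicand_gt0 t.
by rewrite exprVn sqr_sqrtr ?(ltW h) // mulVf // gt_eqF.
Qed.

Lemma tilt_le1 t : tilt t <= 1.
Proof.
have h := tilt_radicand_gt0 t.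
rewrite invf_le1 ?sqrtr_gt0 // -[X in X <= _]sqrtr1 ler_sqrt ?(ltW h) //.
by rewrite lerDl -mulrA mulr_ge0 // flat_sq_ge0.
Qed.

Definition dtilt (t : R) : R :=
  - (2 * flat 2 t ^+ 2 + 4 * t * flat 2 t * (flat 4 t - 2 * flat 3 t)) * tilt t ^+ 3.

Lemma is_derive_tilt (t : R) : is_derive t 1 tilt (dtilt t).
Proof.
have h := tilt_radicand_gt0 t.
have df := is_derive_flat 2 t.
have d1 : is_derive t 1 (fun s => 1 + 4 * s * flat 2 s ^+ 2)
   (4 * flat 2 t ^+ 2 + 8 * t * flat 2 t * (flat 4 t - 2 * flat 3 t)).
  have d2 : is_derive t 1 (fun s : R => 4 * s) 4.
    have := is_deriveZ 4 (is_derive_id t (1 : R)).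
    by move=> d; apply: is_derive_eq d _; rewrite /GRing.scale /= mulr1.
  have d3 := is_deriveD (is_derive_cst (1 : R) t 1) (is_derive_mul d2 (is_derive_exp 2 df)).
  apply: is_derive_eq d3 _; rewrite expr1; ring.
have d2 := @is_derive1_comp _ Num.sqrt (fun s => 1 + 4 * s * flat 2 s ^+ 2) t _ _
  (is_derive1_sqrt h) d1.
have s0 : Num.sqrt (1 + 4 * t * flat 2 t ^+ 2) != 0 by rewrite gt_eqF // sqrtr_gt0.
have d3 := @is_deriveV _ (fun s => Num.sqrt (1 + 4 * s * flat 2 s ^+ 2)) t _ _ s0 d2.
apply: is_derive_eq d3 _; rewrite /dtilt /tilt /GRing.scale /=.
by field.
Qed.


(** The algebra of functions generated by the coordinates, the flat functions
and the tilt, the last two evaluated at |x|^2.  It is stable under directional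
derivatives ([smooth_alg_derive]), so that all its elements are smooth; it
contains f, the entries of the unit normal and of the unit tangent frame, and
the divergence of the normal. *)
Inductive smooth_alg m : ('rV[R]_m -> R) -> Prop :=
| SAcst c : smooth_alg (fun=> c)
| SAcoord j : smooth_alg (fun x => x 0 j)
| SAflat i : smooth_alg (fun x => flat i (nsq x))
| SAtilt : smooth_alg (fun x => tilt (nsq x))
| SAadd f g : smooth_alg f -> smooth_alg g -> smooth_alg (fun x => f x + g x)
| SAmul f g : smooth_alg f -> smooth_alg g -> smooth_alg (fun x => f x * g x).

Lemma SAopp m (f : 'rV[R]_m -> R) : smooth_alg f -> smooth_alg (fun x => - f x).
Proof.
move=> sf; have := SAmul (SAcst m (-1)) sf.
by congr smooth_alg; apply/funext => x; rewrite mulN1r.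
Qed.

Lemma SAexp m (f : 'rV[R]_m -> R) n : smooth_alg f -> smooth_alg (fun x => f x ^+ n).
Proof.
move=> sf; elim: n => [|n IH]; first exact: (SAcst m 1).
have := SAmul sf IH.
by congr smooth_alg; apply/funext => x; rewrite exprS.
Qed.

Lemma SAsum m (I : Type) (s : seq I) (F : I -> 'rV[R]_m -> R) :
  (forall i, smooth_alg (F i)) -> smooth_alg (fun x => \sum_(i <- s) F i x).
Proof.
move=> sF; elim: s => [|i s IH].
  by have := SAcst m 0; congr smooth_alg; apply/funext => x; rewrite big_nil.
by have := SAadd (sF i) IH; congr smooth_alg; apply/funext => x; rewrite big_cons.
Qed.

Lemma SAnsq m : smooth_alg (@nsq R m).
Proof. by apply: SAsum => j; apply: SAexp; exact: SAcoord. Qed.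

Lemma differentiable_sumr m (I : Type) (s : seq I) (F : I -> 'rV[R]_m -> R) x :
  (forall i, differentiable (F i) x) ->
  differentiable (fun x => \sum_(i <- s) F i x) x.
Proof.
move=> dF; elim: s => [|i s IH].
  rewrite (_ : (fun _ => _) = cst 0); first exact: differentiable_cst.
  by apply/funext => y; rewrite big_nil.
rewrite (_ : (fun _ => _) = (F i + (fun x => \sum_(i <- s) F i x))).
  exact: differentiableD.
by apply/funext => y; rewrite big_cons.
Qed.

Lemma differentiable_nsq m (x : 'rV[R]_m) : differentiable (@nsq R m) x.
Proof.
apply: differentiable_sumr => j.
rewrite (_ : (fun _ => _) = (fun x : 'rV[R]_m => x 0 j) * (fun x : 'rV[R]_m => x 0 j)).
  by apply: differentiableM; exact: differentiable_coord.
by apply/funext => y; rewrite expr2.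
Qed.

Lemma is_derive_coord m (x v : 'rV[R]_m) j :
  is_derive x v (fun x => x 0 j) (v 0 j).
Proof.
apply: DeriveDef; first exact/diff_derivable/differentiable_coord.
rewrite /derive.
apply: (cvg_lim (@Rhausdorff R)).
apply: (@cvg_trans _ (cst (v 0 j) @ (0:R)^')); last exact: cvg_cst.
apply: near_eq_cvg; near=> h.
rewrite /= !mxE addrK scalerA mulVf ?scale1r //.
by near: h; exact: nbhs_dnbhs_neq.
Unshelve. all: by end_near. Qed.

Lemma is_derive_sumr m (I : Type) (s : seq I) (F : I -> 'rV[R]_m -> R) x v dF :
  (forall i, is_derive x v (F i) (dF i)) ->
  is_derive x v (fun x => \sum_(i <- s) F i x) (\sum_(i <- s) dF i).
Proof.
move=> hF; elim: s => [|i s IH].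
  rewrite big_nil (_ : (fun _ => _) = cst 0); first exact: is_derive_cst.
  by apply/funext => y; rewrite big_nil.
rewrite big_cons (_ : (fun _ => _) = (F i + (fun x => \sum_(i <- s) F i x))).
  exact: is_deriveD.
by apply/funext => y; rewrite big_cons.
Qed.

Lemma is_derive_nsq m (x v : 'rV[R]_m) :
  is_derive x v (@nsq R m) (2 * (x *m v^T) 0 0).
Proof.
rewrite mxE mulr_sumr; apply: is_derive_sumr => j.
apply: is_derive_eq (is_derive_exp 2 (is_derive_coord x v j)) _.
by rewrite expr1 mxE mulrA.
Qed.

Lemma differentiable_1d (g : R -> R) (t : R) dg : is_derive t 1 g dg -> differentiable g t.
Proof. by move=> h; apply/derivable1_diffP; exact: ex_derive. Qed.

(** The chain rule for directional derivatives. *)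
Lemma is_derive_comp_dir m (g : R -> R) (h : 'rV[R]_m -> R) x v dg dh :
  is_derive (h x) 1 g dg -> differentiable h x -> is_derive x v h dh ->
  is_derive x v (fun y => g (h y)) (dg * dh).
Proof.
move=> gd hd hv; have dgx := differentiable_1d gd.
have dc : differentiable (g \o h) x by exact: differentiable_comp.
apply: DeriveDef; first exact: diff_derivable.
rewrite -[LHS]/('D_v (g \o h) x) deriveE // diff_comp //=.
rewrite -(deriveE _ hd) (derive_val (is_derive := hv)).
have -> : dh = dh *: 1 by rewrite [_ *: 1]mulr1.
rewrite linearZ /= -(deriveE _ dgx) (derive_val (is_derive := gd)).
by rewrite [_ *: _]mulrC [_ *: 1]mulr1.
Qed.

Lemma smooth_alg_differentiable m (f : 'rV[R]_m -> R) x :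
  smooth_alg f -> differentiable f x.
Proof.
elim=> [c|j|i||g h _ dg _ dh|g h _ dg _ dh].
- exact: differentiable_cst.
- exact: differentiable_coord.
- apply: (@differentiable_comp _ _ _ _ (@nsq R m) (flat i)).
    exact: differentiable_nsq.
  exact: differentiable_1d (is_derive_flat _ _).
- apply: (@differentiable_comp _ _ _ _ (@nsq R m) tilt).
    exact: differentiable_nsq.
  exact: differentiable_1d (is_derive_tilt _).
- exact: differentiableD.
- exact: differentiableM.
Qed.

Lemma is_derive_dir m (f : 'rV[R]_m -> R) x v : smooth_alg f ->
  is_derive x v f ('D_v f x).
Proof.
move=> sf; apply: DeriveDef => //; apply: diff_derivable.
exact: smooth_alg_differentiable.
Qed.

Lemma smooth_alg_derive m (f : 'rV[R]_m -> R) v : smooth_alg f -> smooth_alg ('D_v f).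
Proof.
pose lin : 'rV[R]_m -> R := fun x => 2 * (x *m v^T) 0 0.
have slin : smooth_alg lin.
  apply: SAmul; first exact: SAcst.
  rewrite (_ : (fun _ => _) = fun x : 'rV[R]_m => \sum_j x 0 j * v 0 j).
    by apply: SAsum => j; apply: SAmul; [exact: SAcoord|exact: SAcst].
  by apply/funext => x; rewrite mxE; apply: eq_bigr => j _; rewrite mxE.
elim=> [c|j|i||g h sg dg sh dh|g h sg dg sh dh].
- rewrite (_ : 'D_v _ = cst 0); first exact: SAcst.
  by apply/funext => x; exact: derive_cst.
- rewrite (_ : 'D_v _ = cst (v 0 j)); first exact: SAcst.
  by apply/funext => x; exact: (derive_val (is_derive := is_derive_coord x v j)).
- rewrite (_ : 'D_v _ = fun x => (flat i.+2 (nsq x) + - (i%:R * flat i.+1 (nsq x))) * lin x).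
    apply: SAmul => //; apply: SAadd; first exact: SAflat.
    by apply/SAopp/SAmul; [exact: SAcst|exact: SAflat].
  apply/funext => x; apply: (derive_val (is_derive := _)).
  exact: is_derive_comp_dir (is_derive_flat _ _) (differentiable_nsq x) (is_derive_nsq x v).
- rewrite (_ : 'D_v _ = fun x => dtilt (nsq x) * lin x).
    apply: SAmul => //; apply: SAmul; last by apply: SAexp; exact: SAtilt.
    apply/SAopp/SAadd.
      by apply: SAmul; [exact: SAcst|apply: SAexp; exact: SAflat].
    apply: SAmul.
      by repeat apply: SAmul; [exact: SAcst|exact: SAnsq|exact: SAflat].
    apply: SAadd; first exact: SAflat.
    by apply/SAopp/SAmul; [exact: SAcst|exact: SAflat].
  apply/funext => x; apply: (derive_val (is_derive := _)).
  exact: is_derive_comp_dir (is_derive_tilt _) (differentiable_nsq x) (is_derive_nsq x v).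
- rewrite (_ : 'D_v _ = fun x => 'D_v g x + 'D_v h x); first exact: SAadd.
  apply/funext => x; apply: (derive_val (is_derive := _)).
  by apply: is_deriveD; exact: is_derive_dir.
- rewrite (_ : 'D_v _ = fun x => g x * 'D_v h x + h x * 'D_v g x).
    by apply: SAadd; exact: SAmul.
  apply/funext => x; apply: (derive_val (is_derive := _)).
  by apply: is_derive_mul; exact: is_derive_dir.
Qed.

Lemma smooth_alg_continuous m (f : 'rV[R]_m -> R) : smooth_alg f -> continuous f.
Proof.
by move=> sf x; apply: differentiable_continuous; exact: smooth_alg_differentiable.
Qed.

Lemma smooth_alg_smooth m (U : set 'rV[R]_m) (f : 'rV[R]_m -> R) :
  smooth_alg f -> smooth U f.
Proof.
move=> + k; elim: k f => [|k IH] f sf /=.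
  by move=> x _; exact: smooth_alg_continuous.
split=> [x _|v]; first exact: smooth_alg_differentiable.
by apply: IH; exact: smooth_alg_derive.
Qed.

(** The difference quotients of both sides coincide. *)
Lemma derive_lsubmx m n (f : 'rV[R]_m -> R) (p v : 'rV[R]_(m + n)) :
  'D_v (fun q : 'rV[R]_(m + n) => f (lsubmx q)) p = 'D_(lsubmx v) f (lsubmx p).
Proof.
rewrite /derive (_ : (fun h : R => h^-1 *:
    (((fun q : 'rV[R]_(m + n) => f (lsubmx q)) \o shift p) (h *: v) - f (lsubmx p))) =
  (fun h : R => h^-1 *: ((f \o shift (lsubmx p)) (h *: lsubmx v) - f (lsubmx p)))) //.
apply/funext => h /=.
by congr (_ *: (f _ - _)); apply/rowP => j; rewrite !mxE.
Qed.

Lemma smooth_lsubmx m n (U : set 'rV[R]_(m + n)) (f : 'rV[R]_m -> R) :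
  smooth_alg f -> smooth U (fun q : 'rV[R]_(m + n) => f (lsubmx q)).
Proof.
move=> + k; elim: k f => [|k IH] f sf /=.
  move=> p _; apply: (@continuous_comp _ _ _ (@lsubmx R 1 m n) f).
    exact: continuous_lsubmx.
  exact: smooth_alg_continuous.
split=> [p _|v].
  apply: (@differentiable_comp _ _ _ _ (@lsubmx R 1 m n) f).
    exact: differentiable_lsubmx.
  exact: smooth_alg_differentiable.
rewrite (_ : 'D_v _ = fun q => 'D_(lsubmx v) f (lsubmx q)).
  by apply: (IH ('D_(lsubmx v) f)); exact: smooth_alg_derive.
by apply/funext => q; exact: derive_lsubmx.
Qed.

End FlatFunctions.

(** * Lebesgue measure on row vectors *)
Section Measure.
Context {R : realType}.
Local Open Scope ereal_scope.

Section open_sets.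
Context {n : nat}.

Lemma measurable_box (c : 'rV[R]_n) (e : R) :
  measurable [set x : 'rV[R]_n | forall j, (`|c ord0 j - x ord0 j| < e)%R].
Proof.
rewrite (_ : [set x | _] = \big[setI/setT]_(j : 'I_n)
   ((fun x : 'rV[R]_n => x ord0 j) @^-1` (ball (c ord0 j) e))).
  apply: bigsetI_measurable => j _.
  rewrite -[X in measurable X]setTI; apply: measurable_entry => //.
  exact: measurable_ball.
apply/seteqP; split => x.
  by move=> h; rewrite -bigcap_seq => j _; exact: h.
by rewrite -bigcap_seq => h j; apply: h; rewrite /= mem_index_enum.
Qed.

(** An open set is the union of the boxes with rational centre and radius
1 / (k + 1) that it contains. *)
Lemma open_measurable_rV (U : set 'rV[R]_n) : open U -> measurable U.
Proof.
move=> oU.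
pose bx (q : 'rV[rat]_n) (k : nat) := [set x : 'rV[R]_n |
   forall j, (`|map_mx ratr q ord0 j - x ord0 j| < k.+1%:R^-1)%R].
pose F (s : 'rV[rat]_n * nat) := if `[< bx s.1 s.2 `<=` U >] then bx s.1 s.2 else set0.
rewrite (_ : U = \bigcup_s F s); last first.
  apply/seteqP; split => [x Ux|x [s _]]; last first.
    by rewrite /F; case: asboolP => // h /h.
  have /nbhs_ballP[e /= e0 he] := open_nbhs_nbhs (conj oU Ux).
  have [k hk] : exists k, (k.+1%:R^-1 < e / 2 :> R)%R.
    by exists (Num.truncn (e / 2)^-1); rewrite invf_plt ?posrE ?divr_gt0 // truncnS_gt.
  have hq j : exists q : rat, (`|ratr q - x ord0 j| < k.+1%:R^-1)%R.
    have [|q] := @rat_in_itvoo R (x ord0 j - k.+1%:R^-1) (x ord0 j + k.+1%:R^-1).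
      by rewrite ltrBlDr -addrA ltrDl addr_gt0 // invr_gt0.
    rewrite inE /= => /itvP qx; exists q; rewrite ltr_distl !qx.
    by [].
  have [q hq'] := choice hq.
  exists (\row_j q j, k) => //; rewrite /F; case: asboolP => [_ /=|].
    by move=> j; rewrite !mxE.
  case=> y hy; apply: he; split=> // i j; rewrite ord1 -ball_normE /=.
  have := hy j; have := hq' j; rewrite !mxE => h1 h2.
  rewrite (splitr e) (le_lt_trans (ler_distD (ratr (q j)) _ _)) // ltrD //.
    by rewrite distrC (lt_trans h1).
  exact: lt_trans h2 _.
apply: countable_bigcupT_measurable; first exact: countableP.
move=> s; rewrite /F; case: asboolP => // _; exact: measurable_box.
Qed.

Lemma continuous_measurable_rV (f : 'rV[R]_n -> R) :
  continuous f -> measurable_fun setT f.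
Proof.
move=> /continuousP cf; apply: (measurability _ (RGenOpens.measurableE R)) => //.
move=> _ [_ [a [b ->]] <-]; rewrite setTI; apply: open_measurable_rV.
by apply: cf; exact: interval_open.
Qed.
End open_sets.

Lemma rV_cons0 n (p : R * 'rV[R]_n) : rV_cons p ord0 ord0 = p.1.
Proof.
have -> : ord0 = lshift n ord0 :> 'I_(1 + n) by exact: val_inj.
by rewrite /rV_cons (row_mxEl (p.1)%:M p.2) mxE eqxx mulr1n.
Qed.

Lemma rV_consS n (p : R * 'rV[R]_n) j : rV_cons p ord0 (lift ord0 j) = p.2 ord0 j.
Proof.
have -> : lift ord0 j = rshift 1 j :> 'I_(1 + n) by exact: val_inj.
by rewrite /rV_cons (row_mxEr (p.1)%:M p.2).
Qed.

Lemma rV_consZ n l (p : R * 'rV[R]_n) :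
  (l *: rV_cons p = rV_cons (l * p.1, l *: p.2))%R.
Proof.
apply/rowP => j; rewrite mxE; case: (unliftP ord0 j) => [k|] ->.
  by rewrite !rV_consS mxE.
by rewrite !rV_cons0.
Qed.

(** Tonelli's theorem for the recursive definition of Lebesgue measure. *)
Lemma integral_cons n (h : 'rV[R]_n.+1 -> \bar R) :
  measurable_fun [set: _] h -> (forall x, 0 <= h x) ->
  \int[lebesgue_rV R n.+1]_x h x =
  \int[lebesgue_measure]_a \int[lebesgue_rV R n]_x h (rV_cons (a, x)).
Proof.
move=> mh h0.
transitivity (\int[(@lebesgue_measure R \x lebesgue_rV R n)]_z h (rV_cons z)); last first.
  rewrite fubini_tonelli1 //=.
  by apply: measurableT_comp => //; exact: measurable_rV_cons.
have mc : @measurable_fun _ _ (measurableTypeR R * 'rV[R]_n)%type 'rV[R]_n.+1 setT rV_cons.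
  exact: measurable_rV_cons.
rewrite -[RHS](ge0_integral_pushforward mc
  [the measure _ _ of (@lebesgue_measure R \x lebesgue_rV R n)] (D := setT) (f := h)) //.
Qed.

Lemma measurable_mull (l : R) :
  @measurable_fun _ _ (measurableTypeR R) (measurableTypeR R) setT (fun a : R => (l * a)%R).
Proof.
suff : measurable_fun [set: R] (fun a : R => (l * a)%R) by [].
by apply: measurable_funM => //; exact: measurable_id.
Qed.

(** By uniqueness of Lebesgue measure, checked on half-open intervals. *)
Lemma lebesgue_measure_scale (l : R) (A : set R) : (0 < l)%R -> measurable A ->
  lebesgue_measure ((fun a : R => (l * a)%R) @^-1` A) = (l^-1)%:E * lebesgue_measure A.
Proof.
move=> l0 mA.
have l0' : (0 <= l)%R by exact: ltW.
pose pf : {measure set (measurableTypeR R) -> \bar R} :=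
  pushforward lebesgue_measure (fun a : measurableTypeR R => (l * a)%R : measurableTypeR R).
pose mu' : {measure set (measurableTypeR R) -> \bar R} :=
  mscale (NngNum l0') (pf (measurable_mull l)).
have h : lebesgue_measure A = mu' A.
  apply: lebesgue_measure_unique => // _ [[a b] _ <-].
  rewrite /mu' /= /mscale /pushforward /=.
  rewrite -[pushforward _ _ _]/(lebesgue_measure ((fun c : R => (l * c)%R) @^-1` `]a, b]%classic)).
  rewrite (_ : (fun c : R => (l * c)%R) @^-1` `]a, b]%classic =
    `](a / l)%R, (b / l)%R]%classic); last first.
    apply/seteqP; split => x /=; rewrite !in_itv /= ltr_pdivrMr // ler_pdivlMr //;
      by rewrite mulrC.
  rewrite !lebesgue_measure_itv /= !lte_fin ltr_pM2r ?invr_gt0 //.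
  case: ifPn => ab; last by rewrite mule0.
  rewrite -!EFinB -EFinM -mulrBl mulrCA divff ?mulr1 // gt_eqF //.
rewrite [in RHS]h /mu' /= /mscale /= muleA -EFinM mulVf ?mul1e // gt_eqF //.
Qed.

Lemma lebesgue_scale (l : R) (h : measurableTypeR R -> \bar R) : (0 < l)%R ->
  measurable_fun [set: measurableTypeR R] h -> (forall x, 0 <= h x) ->
  \int[lebesgue_measure]_a h (l * a)%R = (l^-1)%:E * \int[lebesgue_measure]_a h a.
Proof.
move=> l0 mh h0.
rewrite -[LHS](ge0_integral_pushforward (measurable_mull l)
  [the measure _ _ of (@lebesgue_measure R)] (D := setT) (f := h)) //.
have l0' : (0 <= l^-1)%R by rewrite invr_ge0 ltW.
have -> : (l^-1)%:E = (NngNum l0')%:num%:E by [].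
rewrite -ge0_integral_mscale //.
pose pf : {measure set (measurableTypeR R) -> \bar R} :=
  pushforward lebesgue_measure (fun a : measurableTypeR R => (l * a)%R : measurableTypeR R).
apply: (@eq_measure_integral _ _ _ _ _ (pf (measurable_mull l))) => A mA _.
exact: lebesgue_measure_scale.
Qed.

Lemma measurable_scale_rV n (l : R) :
  measurable_fun [set: 'rV[R]_n] (fun x : 'rV[R]_n => (l *: x)%R).
Proof.
apply/measurable_fun_matrixP => i j.
under eq_fun do rewrite mxE.
by apply: measurable_funM => //; exact: measurable_entry.
Qed.

Lemma integral_scale_rV n (l : R) (h : 'rV[R]_n -> \bar R) : (0 < l)%R ->
  measurable_fun [set: _] h -> (forall x, 0 <= h x) ->
  \int[lebesgue_rV R n]_x h (l *: x)%R = (l^-1 ^+ n)%:E * \int[lebesgue_rV R n]_x h x.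
Proof.
move=> l0; elim: n h => [|n IH] h mh h0.
  rewrite expr0 mul1e; apply: eq_integral => x _.
  by congr h; apply/rowP => -[].
rewrite !integral_cons //; last first.
  by apply: measurableT_comp => //; exact: measurable_scale_rV.
have mhc : measurable_fun [set: (measurableTypeR R * 'rV[R]_n)%type] (h \o @rV_cons R n).
  by apply: measurableT_comp => //; exact: measurable_rV_cons.
under eq_integral => a _ do under eq_integral => x _ do rewrite rV_consZ /=.
transitivity (\int[lebesgue_measure]_a ((l^-1 ^+ n)%:E *
    \int[lebesgue_rV R n]_x h (rV_cons (l * a, x)%R))).
  apply: eq_integral => a _; apply: (IH (fun x => h (rV_cons (l * a, x)%R))) => //.
  exact: (measurableT_comp mhc (pair1_measurable _)).
have l1 : (0 <= l^-1)%R by rewrite invr_ge0 ltW.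
pose F a := \int[lebesgue_rV R n]_x h (rV_cons (a, x)).
have mF : measurable_fun [set: measurableTypeR R] F.
  apply: (@measurable_fun_fubini_tonelli_F _ _ (measurableTypeR R) 'rV[R]_n R
    (lebesgue_rV R n) (h \o @rV_cons R n)) => //=.
have F0 a : 0 <= F a by exact: integral_ge0.
transitivity ((l^-1 ^+ n)%:E * \int[lebesgue_measure]_a F (l * a)%R); last first.
  by rewrite (lebesgue_scale l0 mF F0) muleA -EFinM exprSr.
apply: (@ge0_integralZl _ (measurableTypeR R) R lebesgue_measure setT measurableT
  (fun a => F (l * a)%R)) => //; last by rewrite lee_fin exprn_ge0.
by apply: (measurableT_comp mF); exact: measurable_mull.
Qed.

Definition cube n (a b : R) := [set x : 'rV[R]_n | forall j, (a <= x ord0 j <= b)%R].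

(** Cubes suffice to compare volumes: the unit ball has finite volume because a
cube contains it, and an annulus has positive volume because it contains a
cube. *)
Lemma lebesgue_cube n (a b : R) : (a <= b)%R ->
  measurable (@cube n a b) /\ lebesgue_rV R n (cube a b) = ((b - a) ^+ n)%:E.
Proof.
move=> ab.
have mc k : measurable (@cube k a b).
  rewrite (_ : cube a b = \big[setI/setT]_(j : 'I_k)
     ((fun x : 'rV[R]_k => x ord0 j) @^-1` `[a, b]%classic)).
    apply: bigsetI_measurable => j _.
    by rewrite -[X in measurable X]setTI; apply: measurable_entry.
  apply/seteqP; split => x.
    by move=> h; rewrite -bigcap_seq => j _; rewrite /= in_itv /=; exact: h.
  rewrite -bigcap_seq => h j; have := h j; rewrite /= in_itv /=; apply.
  by rewrite /= mem_index_enum.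
split=> //; elim: n => [|n IH].
  by rewrite /= expr0 diracE (_ : 0%R \in _) // inE => -[].
transitivity ((@lebesgue_measure R \x lebesgue_rV R n) (`[a, b]%classic `*` cube a b)).
  rewrite /= /lebesgue_cons /pushforward; congr ((_ \x _) _).
  apply/seteqP; split => -[c x] /=; rewrite in_itv /=.
    move=> h; split; first by have := h ord0; rewrite rV_cons0.
    by move=> j; have := h (lift ord0 j); rewrite rV_consS.
  move=> [h1 h2] j; case: (unliftP ord0 j) => [k|] ->; first by rewrite rV_consS.
  by rewrite rV_cons0.
rewrite product_measure1E; [|exact: measurable_itv|exact: mc].
rewrite IH exprS EFinM; congr (_ * _).
transitivity (@lebesgue_measure R `[a, b]%classic) => //.
rewrite lebesgue_measure_itv /= lte_fin.
by move: ab; case: ltgtP => // -> _; rewrite subrr.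
Qed.

End Measure.

(** * Push-forward of a weighted measure *)
Section WeightedPushforward.
Context d1 d2 (X : measurableType d1) (Y : measurableType d2) (R : realType).
Variables (mu : {measure set X -> \bar R}) (D : set X) (g : X -> Y) (w : X -> R).
Hypotheses (mD : measurable D) (mg : measurable_fun [set: X] g).
Hypotheses (mw : measurable_fun [set: X] w) (w0 : forall x, (0 <= w x)%R).
Local Open Scope ereal_scope.
Import HBNNSimple.

(** The image under g of the measure w mu on D.  With the graph map and the area
factor, this is the mass measure of a graph. *)
Definition wpush (A : set Y) : \bar R := \int[mu]_(x in D `&` g @^-1` A) (w x)%:E.

Let mDg A : measurable A -> measurable (D `&` g @^-1` A).
Proof. by move=> mA; apply: measurableI => //; rewrite -[X in measurable X]setTI; exact: mg. Qed.

Let mwE E : measurable_fun E (fun x => (w x)%:E).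
Proof. by apply/measurable_EFinP; exact: measurable_funTS. Qed.

Lemma wpush0 : wpush set0 = 0.
Proof. by rewrite /wpush preimage_set0 setI0 integral_set0. Qed.

Lemma wpush_ge0 A : 0 <= wpush A.
Proof. by apply: integral_ge0 => x _; rewrite lee_fin. Qed.

Lemma wpush_sigma_additive : semi_sigma_additive wpush.
Proof.
move=> F mF tF mUF; rewrite /wpush preimage_bigcup setI_bigcupr.
rewrite ge0_integral_bigcup //; last 3 first.
- by move=> i; exact: mDg.
- by move=> x _; rewrite lee_fin.
- apply/trivIsetP => i j _ _ ij; move/trivIsetP : tF => /(_ i j Logic.I Logic.I ij) h.
  have -> : D `&` g @^-1` F i `&` (D `&` g @^-1` F j) = D `&` g @^-1` (F i `&` F j).
    by rewrite setIACA setIid.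
  by rewrite h preimage_set0 setI0.
by apply: is_cvg_nneseries => i _ _; apply: integral_ge0 => x _; rewrite lee_fin.
Qed.

(** Change of variables, by approximation with simple functions. *)
Lemma ge0_integral_wpush (nu : {measure set Y -> \bar R}) (h : Y -> \bar R) :
  (forall A, measurable A -> nu A = wpush A) ->
  measurable_fun [set: Y] h -> (forall y, 0 <= h y) ->
  \int[nu]_y h y = \int[mu]_(x in D) (h (g x) * (w x)%:E).
Proof.
move=> nuE mh h0.
pose f_ := nnsfun_approx measurableT mh.
have mfg n : measurable_fun [set: X] (f_ n \o g).
  by apply: measurableT_comp => //; exact: measurable_funP.
transitivity (limn (fun n => \int[nu]_y (f_ n y)%:E)).
  rewrite -monotone_convergence //.
  - apply: eq_integral => y _; apply/esym/cvg_lim => //.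
    by apply: cvg_nnsfun_approx => // *; exact: h0.
  - by move=> n; exact/measurable_EFinP/measurable_funP.
  - by move=> n y _; rewrite lee_fin.
  - by move=> y _ m n mn; rewrite lee_fin; exact/lefP/nd_nnsfun_approx.
rewrite [X in limn X](_ : _ =
    (fun n => \int[mu]_(x in D) ((f_ n (g x))%:E * (w x)%:E))).
  rewrite -monotone_convergence //; last 3 first.
  - move=> n; apply: emeasurable_funM => //.
    by apply/measurable_EFinP; exact: measurable_funTS (mfg n).
  - by move=> n x _; rewrite mule_ge0 // lee_fin.
  - move=> x _ m n mn; rewrite lee_wpmul2r ?lee_fin //.
    exact/lefP/nd_nnsfun_approx.
  apply: eq_integral => x _; apply/cvg_lim => //.
  apply: cvgeMr => //.
  by apply: cvg_nnsfun_approx => // *; exact: h0.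
apply/funext => n; set f := f_ n.
have mA k : measurable (f @^-1` [set k]) by [].
have mA' k : measurable (g @^-1` (f @^-1` [set k])).
  by rewrite -[X in measurable X]setTI; exact: mg.
transitivity (\sum_(k \in range f) (k%:E * nu (f @^-1` [set k]))).
  rewrite integralT_nnsfun sintegralE; apply: eq_fsbigr => k _.
  by [].
under [RHS]eq_integral => x _.
  rewrite -EFinM fimfunE mulr_fsuml //. rewrite -fsumEFin //. over.
rewrite ge0_integral_fsum //; last 2 first.
- move=> k; apply/measurable_EFinP; apply: measurable_funM; last exact: measurable_funTS.
  apply: measurable_funM => //; apply: measurable_funTS.
  exact: (measurable_indic (mA' k)).
- move=> k x _; rewrite lee_fin mulr_ge0 //.
  exact: nnfun_muleindic_ge0.
apply: eq_fsbigr => k kf.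
have k0 : (0 <= k)%R.
  by move: kf; rewrite inE /= => -[y _ <-].
rewrite nuE // /wpush.
rewrite integral_mkcondr -ge0_integralZl //; last 2 first.
- by apply/(measurable_restrict _ (mA' k)) => //; exact: mwE.
- by move=> x _; rewrite patchE; case: ifP => //; rewrite lee_fin.
apply: eq_integral => x _; rewrite patchE indicE /preimage.
case: ifPn => h1.
  by rewrite mem_set ?mulr1 ?EFinM //; move: h1; rewrite inE.
by rewrite memNset ?mulr0 ?mul0r ?mule0 //; move: h1; rewrite notin_setE.
Qed.

(** The integral of any measurable function is the difference of those of its
positive and negative parts, and each of these is covered by [ge0_integral_wpush]. *)
Lemma integral_wpush (nu : {measure set Y -> \bar R}) (h : Y -> \bar R) :
  (forall A, measurable A -> nu A = wpush A) ->
  measurable_fun [set: Y] h ->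
  \int[nu]_y h y = \int[mu]_(x in D) (h (g x) * (w x)%:E).
Proof.
move=> nuE mh; rewrite [LHS]integralE [RHS]integralE.
rewrite (ge0_integral_wpush nuE) //; last exact/measurable_funepos.
rewrite (ge0_integral_wpush nuE) //; last exact/measurable_funeneg.
congr (_ - _); apply: eq_integral => x _.
  by rewrite !funeposE maxe_pMl ?lee_fin // mul0e.
by rewrite !funenegE maxe_pMl ?lee_fin // mul0e mulNe.
Qed.

End WeightedPushforward.

(** * Geometry of the flat graph *)
Section Geometry.
Context {R : realType} {m : nat}.
Implicit Types (x : 'rV[R]_m) (p : 'rV[R]_(m + 1)).

Definition flat_graph x : R := flat 0 (nsq x).

Definition flat_grad x : 'rV[R]_m := (2 * flat 2 (nsq x)) *: x.

Definition unit_normal x : 'rV[R]_(m + 1) := normal_row (tilt (nsq x)) (flat_grad x).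

(** Rescaling one row of the tangent frame (1 | grad f^T) is enough to make its
Gram determinant equal to 1. *)
Definition first_scale (c : R) : 'M[R]_m :=
  diag_mx (\row_i (if val i == 0%N then c else 1)).

Definition unit_frame x : 'M[R]_(m, m + 1) :=
  first_scale (tilt (nsq x)) *m row_mx 1%:M (flat_grad x)^T.

Lemma det_first_scale c : (0 < m)%N -> \det (first_scale c) = c.
Proof.
move=> m0; rewrite det_diag (bigD1 (Ordinal m0)) //= mxE /= big1 ?mulr1 // => i.
by rewrite mxE -(inj_eq val_inj) /= => /negPf ->.
Qed.

Lemma nsq_flat_grad x : nsq (flat_grad x) = 4 * nsq x * flat 2 (nsq x) ^+ 2.
Proof. by rewrite nsqZ; ring. Qed.

Lemma nsq_unit_normal x : nsq (unit_normal x) = 1.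
Proof. by rewrite nsq_normal_row nsq_flat_grad tilt_sq. Qed.

Lemma unit_frame_normal x : unit_frame x *m (unit_normal x)^T = 0.
Proof. exact: mul_frame_normal. Qed.

Lemma det_unit_frame_normal x : (0 < m)%N ->
  \det (col_mx (unit_frame x) (unit_normal x)) = 1.
Proof.
move=> m0; rewrite det_frame_normal det_first_scale // nsq_flat_grad.
by rewrite mulrA -expr2 tilt_sq.
Qed.

Lemma gram_unit_frame x : (0 < m)%N -> \det (unit_frame x *m (unit_frame x)^T) = 1.
Proof.
move=> m0; have := det_col_mx_orth (unit_frame_normal x).
by rewrite det_unit_frame_normal // nsq_unit_normal expr1n mulr1.
Qed.

Lemma mvnorm_unit_frame x : (0 < m)%N -> mvnorm (unit_frame x) = 1.
Proof. by move=> m0; rewrite /mvnorm gram_unit_frame // sqrtr1. Qed.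

Lemma orthproj_unit_frame x : (0 < m)%N ->
  orthproj (unit_frame x) = 1%:M - (unit_normal x)^T *m unit_normal x.
Proof.
move=> m0; apply: orthproj_hyperplane.
- by rewrite unitmxE gram_unit_frame // unitr1.
- exact: unit_frame_normal.
- exact: nsq_unit_normal.
Qed.

Definition vert : 'rV[R]_(m + 1) := row_mx 0 1%:M.

(** The base plane is the hyperplane normal to [vert]. *)
Lemma orthproj_base : orthproj (@base_plane R m) = 1%:M - vert^T *m vert.
Proof.
apply: orthproj_hyperplane.
- by rewrite tr_row_mx mul_row_col trmx1 mulmx1 mul0mx addr0 unitmx1.
- by rewrite tr_row_mx mul_row_col trmx0 mulmx0 mul0mx addr0.
- by rewrite nsq_row_mx nsq0 nsq_scalar expr1n add0r.
Qed.

Lemma mul_vert p : p *m (vert^T *m vert) = row_mx 0 (rsubmx p).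
Proof.
rewrite mulmxA -{1}(hsubmxK p) tr_row_mx mul_row_col trmx0 mulmx0 add0r trmx1 mulmx1.
by rewrite /vert mul_mx_row mulmx0 mulmx1.
Qed.

Lemma mul_orthproj_base p : p *m orthproj (@base_plane R m) = row_mx (lsubmx p) 0.
Proof.
rewrite orthproj_base mulmxBr mulmx1 mul_vert -{1}(hsubmxK p) opp_row_mx add_row_mx.
by rewrite oppr0 addr0 subrr.
Qed.

Lemma mul_orthproj_baseC p :
  p *m (1%:M - orthproj (@base_plane R m)) = row_mx 0 (rsubmx p).
Proof. by rewrite orthproj_base opprB addrC subrK mul_vert. Qed.

Lemma proj_norm_base p : proj_norm (@base_plane R m) p = Num.sqrt (nsq (lsubmx p)).
Proof. by rewrite /proj_norm mul_orthproj_base hsnorm_row nsq_row_mx nsq0 addr0. Qed.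

Lemma dist_base_plane p : dist_plane (@base_plane R m) p ^+ 2 = nsq (rsubmx p).
Proof.
suff -> : dist_plane (@base_plane R m) p = Num.sqrt (nsq (rsubmx p)).
  by rewrite sqr_sqrtr // nsq_ge0.
rewrite /dist_plane; set S := [set _ | _ in _].
have lbS : lbound S (Num.sqrt (nsq (rsubmx p))).
  move=> _ [q /submxP[u ->] <-]; rewrite hsnorm_row ler_wsqrtr //.
  rewrite -{2}(hsubmxK p) /base_plane mul_mx_row mulmx0 mulmx1 opp_row_mx add_row_mx.
  by rewrite nsq_row_mx oppr0 addr0 lerDr nsq_ge0.
have Sp : S (Num.sqrt (nsq (rsubmx p))).
  exists (lsubmx p *m base_plane m); first exact: submxMl.
  rewrite hsnorm_row -{1}(hsubmxK p) /base_plane mul_mx_row mulmx0 mulmx1.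
  by rewrite opp_row_mx add_row_mx nsq_row_mx subrr nsq0 add0r oppr0 addr0.
apply/le_anti/andP; split.
  by apply: ge_inf => //; exists (Num.sqrt (nsq (rsubmx p))).
by apply: lb_le_inf => //; exists (Num.sqrt (nsq (rsubmx p))).
Qed.

(** The squared Hilbert-Schmidt distance between the hyperplanes normal to u
and v is 2 sin^2 of the angle between u and v. *)
Lemma hsnorm_rank1_diff n (u v : 'rV[R]_n) : nsq u = 1 -> nsq v = 1 ->
  hsnorm (u^T *m u - v^T *m v) ^+ 2 = 2 * (1 - (\sum_i u 0 i * v 0 i) ^+ 2).
Proof.
move=> u1 v1; rewrite /hsnorm sqr_sqrtr; last first.
  by apply: sumr_ge0 => i _; apply: sumr_ge0 => j _; exact: sqr_ge0.
set s := \sum_i _ * _.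
transitivity (\sum_i (u 0 i ^+ 2 * nsq u - 2 * (u 0 i * v 0 i * s) + v 0 i ^+ 2 * nsq v)).
  apply: eq_bigr => i _; rewrite !mulr_sumr -sumrB -big_split /=.
  by apply: eq_bigr => j _; rewrite !mxE !big_ord1 !mxE; ring.
rewrite big_split /= sumrB -mulr_sumr -!mulr_suml -/(nsq u) -/(nsq v) -/s u1 v1.
by ring.
Qed.

Lemma tangent_tilt x : (0 < m)%N ->
  hsnorm (orthproj (unit_frame x) - orthproj (@base_plane R m)) ^+ 2 =
  2 * (1 - tilt (nsq x) ^+ 2).
Proof.
move=> m0; rewrite orthproj_unit_frame // orthproj_base.
rewrite opprB addrCA addrAC subrr add0r.
rewrite hsnorm_rank1_diff ?nsq_unit_normal //; last first.
  by rewrite nsq_row_mx nsq0 nsq_scalar expr1n add0r.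
congr (2 * (1 - _ ^+ 2)); rewrite big_split_ord /= big1 ?add0r => [|j _].
  by rewrite big_ord1 !row_mxEr !mxE mul1r.
by rewrite row_mxEl mxE mul0r.
Qed.

Lemma mulmx_delta n (y : 'rV[R]_n) j : (y *m (delta_mx 0 j : 'rV[R]_n)^T) 0 0 = y 0 j.
Proof. by rewrite trmx_delta -colE mxE. Qed.

Lemma is_derive_flat_graph x v :
  is_derive x v flat_graph ((flat_grad x *m v^T) 0 0).
Proof.
have := is_derive_comp_dir (is_derive_flat 0 (nsq x)) (differentiable_nsq x) (is_derive_nsq x v).
move=> d; apply: is_derive_eq d _.
by rewrite /flat_grad -scalemxAl [RHS]mxE; ring.
Qed.

(** The graph map is a sum of scalar functions times constant vectors. *)
Lemma differentiable_graph_map x : differentiable (graph_map flat_graph) x.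
Proof.
rewrite (_ : graph_map flat_graph =
   (\sum_(j < m) (fun y : 'rV[R]_m => y 0 j *: row_mx (delta_mx 0 j) (0 : 'rV[R]_1)))
   + (fun y => flat_graph y *: (vert : 'rV[R]_(m + 1)))); last first.
  apply/funext => y; rewrite !fctE /graph_map /vert.
  have -> : (\sum_(j < m) (fun y : 'rV[R]_m => y 0 j *: row_mx (delta_mx 0 j) (0 : 'rV[R]_1))) y =
     \sum_(j < m) y 0 j *: row_mx (delta_mx 0 j) (0 : 'rV[R]_1).
    by rewrite fct_sumE.
  under eq_bigr do rewrite scale_row_mx scaler0.
  rewrite scale_row_mx scaler0 scale_scalar_mx mulr1.
  have -> : \sum_(j < m) row_mx (y 0 j *: delta_mx 0 j) (0 : 'rV[R]_1) = row_mx y 0.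
    apply/rowP => k; rewrite summxE; case: (split_ordP k) => l ->.
      rewrite row_mxEl [in RHS](row_sum_delta y) summxE; apply: eq_bigr => j _.
      by rewrite row_mxEl.
    by rewrite row_mxEr big1 ?mxE // => j _; rewrite row_mxEr mxE.
  by rewrite add_row_mx addr0 add0r.
apply: differentiableD.
  by apply: differentiable_sum => j; apply: differentiableZl; exact: differentiable_coord.
by apply: differentiableZl; apply: smooth_alg_differentiable; exact: SAflat.
Qed.

Lemma jacobian_graph_map x :
  'J (graph_map flat_graph) x = row_mx 1%:M (flat_grad x)^T.
Proof.
apply/row_matrixP => i; rewrite rowE.
have dg := differentiable_graph_map x.
rewrite -deriveEjacobian // derive_mx; last exact: diff_derivable.
apply/rowP => k; rewrite mxE mxE; case: (split_ordP k) => l ->.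
  rewrite row_mxEl (_ : (fun s => _) = fun s : 'rV[R]_m => s 0 l).
    by rewrite (derive_val (is_derive := is_derive_coord x (delta_mx 0 i) l)) !mxE eq_sym.
  by apply/funext => s; rewrite /graph_map row_mxEl.
rewrite row_mxEr (_ : (fun s => _) = flat_graph).
  rewrite (derive_val (is_derive := is_derive_flat_graph x (delta_mx 0 i))).
  by rewrite mulmx_delta !mxE ord1.
by apply/funext => s; rewrite /graph_map row_mxEr mxE ord1 eqxx mulr1n.
Qed.


Lemma unit_normal_smooth j : smooth_alg (fun x => unit_normal x 0 j).
Proof.
case: (split_ordP j) => k ->.
  rewrite (_ : (fun _ => _) = fun x : 'rV[R]_m => - (tilt (nsq x) * (2 * flat 2 (nsq x) * x 0 k))).
    apply/SAopp/SAmul; first exact: SAtilt.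
    apply: SAmul; last exact: SAcoord.
    by apply: SAmul; [exact: SAcst|exact: SAflat].
  by apply/funext => x; rewrite row_mxEl !mxE.
rewrite (_ : (fun _ => _) = fun x : 'rV[R]_m => tilt (nsq x)); first exact: SAtilt.
by apply/funext => x; rewrite row_mxEr mxE ord1 eqxx mulr1n.
Qed.

(** The unit normal of the graph, extended to be constant on vertical lines. *)
Definition normal_field p : 'rV[R]_(m + 1) := unit_normal (lsubmx p).

Definition normal_jac p : 'M[R]_(m + 1) :=
  \matrix_(i, j) 'D_(delta_mx 0 i) (fun q => normal_field q 0 j) p.

Lemma differentiable_normal_field p j : differentiable (fun q => normal_field q 0 j) p.
Proof.
have [+ _] := @smooth_lsubmx _ _ 1 setT _ (unit_normal_smooth j) 1%N; exact.
Qed.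

Lemma derive_normal_field p v j :
  'D_v (fun q => normal_field q 0 j) p = (v *m normal_jac p) 0 j.
Proof.
have dj := differentiable_normal_field p j.
rewrite deriveE // {1}(row_sum_delta v) linear_sum mxE; apply: eq_bigr => i _.
by rewrite linearZ /= -deriveE // mxE.
Qed.

(** The divergence of the normal field as a function of t = |x|^2.  The
horizontal part of the normal is - a(t) x with a = 2 tau k, where tau is [tilt]
and k is [flat 2], and its divergence is - (m a + 2 t a'). *)
Definition mean_curv (t : R) : R :=
  - (m%:R * (2 * tilt t * flat 2 t) +
     4 * t * (flat 2 t * dtilt t + tilt t * (flat 4 t - 2 * flat 3 t))).

Lemma trace_normal_jac p : \tr (normal_jac p) = mean_curv (nsq (lsubmx p)).
Proof.
set x := lsubmx p.
have e (j : 'I_(m + 1)) : normal_jac p j j =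
    'D_(lsubmx (delta_mx 0 j : 'rV[R]_(m + 1))) (fun y => unit_normal y 0 j) x.
  by rewrite mxE (derive_lsubmx (fun y => unit_normal y 0 j)).
rewrite /mxtrace big_split_ord /= big_ord1 [X in _ + X](_ : _ = 0) ?addr0; last first.
  rewrite e (_ : lsubmx _ = 0) ?derive0 //.
  by apply/rowP => k; rewrite !mxE (eq_sym (lshift _ _)) eq_rlshift andbF.
pose h (t : R) := - (2 * (tilt t * flat 2 t)).
pose dh := - (2 * (tilt (nsq x) * (flat 4 (nsq x) - 2 * flat 3 (nsq x)) +
  flat 2 (nsq x) * dtilt (nsq x))).
have hd : is_derive (nsq x) 1 h dh.
  have d1 := is_derive_mul (is_derive_tilt (nsq x)) (is_derive_flat 2 (nsq x)).
  have d2 := is_deriveN (is_deriveZ 2 d1).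
  exact: d2.
transitivity (\sum_(j < m) (h (nsq x) + 2 * dh * x 0 j ^+ 2)).
  apply: eq_bigr => j _; rewrite e.
  rewrite (_ : (fun y => _) = fun y : 'rV[R]_m => h (nsq y) * y 0 j); last first.
    by apply/funext => y; rewrite row_mxEl !mxE /h; ring.
  have -> : lsubmx (delta_mx 0 (lshift 1 j) : 'rV[R]_(m + 1)) = delta_mx 0 j.
    by apply/rowP => k; rewrite !mxE eq_lshift.
  have d1 := is_derive_comp_dir hd (differentiable_nsq x) (is_derive_nsq x (delta_mx 0 j)).
  have d2 := is_derive_mul d1 (is_derive_coord x (delta_mx 0 j) j).
  rewrite (derive_val (is_derive := d2)) mxE !eqxx mulr1.
  by rewrite mulmx_delta; ring.
rewrite big_split /= sumr_const card_ord -mulr_sumr -/(nsq x) /mean_curv -mulr_natl /h /dh.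
by ring.
Qed.

(** The conormal form: it evaluates to 1 on the oriented unit tangent m-vectors
of the graph and its vertical translates.  Putting the normal in the last row
avoids a sign in [det_frame_normal]. *)
Definition calib : @mform R m (m + 1) := fun p A => \det (col_mx A (normal_field p)).

Lemma calibE p A : calib p A = \sum_j normal_field p 0 j * last_cofactor A j.
Proof. exact: det_col_mx_sum. Qed.

Lemma derive_calib p v A : 'D_v (fun q => calib q A) p = \det (col_mx A (v *m normal_jac p)).
Proof.
rewrite det_col_mx_sum (_ : (fun q => _) = fun q => \sum_j normal_field q 0 j * last_cofactor A j).
  apply: (derive_val (is_derive := _)); apply: is_derive_sumr => j.
  have d : is_derive p v (fun q => normal_field q 0 j) ((v *m normal_jac p) 0 j).
    apply: DeriveDef; last exact: derive_normal_field.
    exact/diff_derivable/differentiable_normal_field.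
  apply: is_derive_eq (is_derive_mul d (is_derive_cst (last_cofactor A j) p v)) _.
  by rewrite mulr0 add0r mulrC.
by apply/funext => q; exact: calibE.
Qed.

(** Up to the order of the vectors, the exterior derivative of the conormal form
of a vector field is the divergence of the field times the volume form. *)
Lemma extd_calib p (X : 'rV[R]_(m + 1)) A :
  Defs.contract (extd calib p) X A = mean_curv (nsq (lsubmx p)) * \det (col_mx A X).
Proof.
rewrite -trace_normal_jac -trace_det_sum /Defs.contract /extd.
by apply: eq_bigr => i _; rewrite derive_calib.
Qed.

Lemma row'_col_mx k n (A B : 'M[R]_(k, n)) (v : 'rV[R]_n) i : row' i B = row' i A ->
  row' (lshift 1 i) (col_mx B v) = row' (lshift 1 i) (col_mx A v).
Proof.
move=> BA; apply/matrixP => a b; rewrite ![row' _ _ _ _]mxE.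
have := neq_lift (lshift 1 i) a; case: (split_ordP (lift (lshift 1 i) a)) => c -> h.
  rewrite !col_mxEu; move: h; case: (unliftP i c) => [d|] -> h; last by rewrite eqxx in h.
  by move/matrixP : BA => /(_ d b); rewrite !mxE.
by rewrite !col_mxEd.
Qed.

Lemma mcovector_calib p : mcovector (calib p).
Proof.
split=> [A B C i b c rA rB rC|A i j ij rij].
  apply: (@determinant_multilinear _ _ _ _ _ (lshift 1 i)).
  - by rewrite !rowKu.
  - exact: row'_col_mx.
  - exact: row'_col_mx.
apply: (@determinant_alternate _ _ _ (lshift 1 i) (lshift 1 j)).
  by rewrite eq_lshift.
by move=> k; rewrite !col_mxEu; move/rowP : rij => /(_ k); rewrite !mxE.
Qed.

Lemma calib_Ck U : form_Ck 1 U calib.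
Proof.
split=> [p _|A]; first exact: mcovector_calib.
rewrite (_ : (fun p => _) =
  fun p => (fun x => \sum_j unit_normal x 0 j * last_cofactor A j) (lsubmx p)).
  apply: (@smooth_lsubmx _ _ 1 U (fun x => \sum_j unit_normal x 0 j * last_cofactor A j) _ 1%N).
  by apply: SAsum => j; apply: SAmul; [exact: unit_normal_smooth|exact: SAcst].
by apply/funext => p; exact: calibE.
Qed.

(** An m-vector of norm 1 has a Gram determinant equal to 1. *)
Lemma comass_calib p : (comass (calib p) <= 1)%E.
Proof.
apply: ub_ereal_sup => _ [A /= A1 <-]; rewrite lee_fin.
have gA : \det (A *m A^T) = 1.
  have : 0 < \det (A *m A^T) by rewrite -sqrtr_gt0 -/(mvnorm A) A1.
  by move=> /ltW h; rewrite -[LHS]sqr_sqrtr // -/(mvnorm A) A1 expr1n.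
have := @det_col_mx_le R m A (normal_field p).
rewrite gA ltr01 mul1r nsq_unit_normal => /(_ isT) h.
rewrite (le_trans (ler_norm _)) // -[leRHS]sqrtr1 -sqrtr_sqr ler_wsqrtr //.
Qed.

Lemma semicalibration_calib U : semicalibration U calib.
Proof. by split; [exact: calib_Ck|move=> p _; exact: comass_calib]. Qed.

Lemma det_frame_vert x (y : 'M[R]_1) : (0 < m)%N ->
  \det (col_mx (unit_frame x) (row_mx 0 y)) = tilt (nsq x) * y 0 0.
Proof.
move=> m0; rewrite /unit_frame mul_mx_row mulmx1 -block_mxEv det_ublock.
by rewrite det_first_scale // det_mx11.
Qed.

Lemma gradient_proj_norm p : 0 < nsq (lsubmx p) ->
  gradient (proj_norm (@base_plane R m)) p =
  (Num.sqrt (nsq (lsubmx p)))^-1 *: row_mx (lsubmx p) 0.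
Proof.
move=> t0; apply/rowP => j; rewrite mxE.
rewrite (_ : proj_norm _ = fun q => (fun x => Num.sqrt (nsq x)) (lsubmx q)); last first.
  by apply/funext => q; exact: proj_norm_base.
rewrite (derive_lsubmx (fun y => Num.sqrt (nsq y))).
have d := is_derive_comp_dir (is_derive1_sqrt t0) (differentiable_nsq (lsubmx p))
  (is_derive_nsq (lsubmx p) (lsubmx (delta_mx 0 j))).
rewrite (derive_val (is_derive := d)).
have s0 : Num.sqrt (nsq (lsubmx p)) != 0 by rewrite gt_eqF // sqrtr_gt0.
rewrite [RHS]mxE.
have -> : (lsubmx p *m (lsubmx (delta_mx 0 j : 'rV[R]_(m + 1)))^T) 0 0 =
    row_mx (lsubmx p) 0 0 j.
  case: (split_ordP j) => k ->.
    have -> : lsubmx (delta_mx 0 (lshift 1 k) : 'rV[R]_(m + 1)) = delta_mx 0 k.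
      by apply/rowP => l; rewrite !mxE eq_lshift.
    by rewrite mulmx_delta row_mxEl.
  rewrite row_mxEr (_ : lsubmx (delta_mx 0 (rshift m k) : 'rV[R]_(m + 1)) = 0)
    ?trmx0 ?mulmx0 ?mxE //.
  by apply/rowP => l; rewrite !mxE (eq_sym (lshift _ _)) eq_rlshift andbF.
by field.
Qed.

(** The radial unit vector u of the base loses exactly its component along the
normal, so the squared norm is 1 - <u, nu>^2 = 1 - |grad f|^2 tau^2 = tau^2. *)
Lemma nsq_tangent_radial x : (0 < m)%N -> 0 < nsq x ->
  nsq ((Num.sqrt (nsq x))^-1 *: row_mx x 0 *m orthproj (unit_frame x)) = tilt (nsq x) ^+ 2.
Proof.
move=> m0 t0; set u := _ *: _.
have u1 : nsq u = 1.
  by rewrite nsqZ nsq_row_mx nsq0 addr0 exprVn sqr_sqrtr ?nsq_ge0 // mulVf // gt_eqF.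
have uA : unit_frame x *m (unit_frame x)^T \in unitmx.
  by rewrite unitmxE gram_unit_frame // unitr1.
have := nsq_orthproj u uA; rewrite u1 => h.
have -> : nsq (u *m orthproj (unit_frame x)) = 1 - nsq (u - u *m orthproj (unit_frame x)).
  by rewrite [X in X - _]h addrAC subrr add0r.
have -> : u - u *m orthproj (unit_frame x) = ((u *m (unit_normal x)^T) 0 0) *: unit_normal x.
  rewrite orthproj_unit_frame // mulmxBr mulmx1 opprB addrCA subrr addr0 mulmxA.
  by rewrite -mul_scalar_mx -mx11_scalar.
rewrite nsqZ nsq_unit_normal mulr1 /u -scalemxAl mxE tr_row_mx mul_row_col mul0mx addr0.
have -> : (x *m (- (tilt (nsq x) *: flat_grad x))^T) 0 0 =
    - (tilt (nsq x) * (2 * flat 2 (nsq x)) * nsq x).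
  by rewrite mxE {4}/nsq mulr_sumr -sumrN; apply: eq_bigr => j _; rewrite !mxE; ring.
rewrite exprMn exprVn sqr_sqrtr ?nsq_ge0 //.
have := tilt_sq (nsq x); have t1 : nsq x != 0 by rewrite gt_eqF.
move=> e; rewrite -[X in X - _]e; field.
by [].
Qed.

End Geometry.

(** * One-dimensional estimates *)
Section Estimates.
Context {R : realType}.

Lemma derive1_affine (f : R -> R) (a u v : R) :
  (\near a, u + v * a = f a) -> derive1 f a = v.
Proof.
move=> h; rewrite derive1E; apply: (derive_val (is_derive := _)).
apply: (@near_eq_is_derive _ _ _ (fun b => u + v * b)) => //.
have := is_deriveD (is_derive_cst u a (1 : R)) (is_deriveZ v (is_derive_id a (1 : R))).
by move=> d; apply: is_derive_eq d _; rewrite add0r [_ *: _]mulr1.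
Qed.

(** At a kink the two-sided limit of the difference quotients either exists, and
is then the left one, or does not exist, and then [lim] is the default value,
which is 0 too. *)
Lemma derive1_eq0_left (f : R -> R) (a d : R) : 0 < d ->
  (forall b, a - d < b < a -> f b = f a) -> derive1 f a = 0.
Proof.
move=> d0 h; rewrite /derive1; set q := (fun h => _).
have q0 : q x @[x --> 0^'-] --> (0 : R).
  apply: (@cvg_trans _ (cst (0 : R) @ (0:R)^'-)); last exact: cvg_cst.
  apply: near_eq_cvg; rewrite /q; near=> e.
  rewrite /= h ?subrr ?scaler0 //.
  rewrite -ltrBlDr addrAC subrr sub0r gtrDr; apply/andP; split; near: e.
    by apply: nbhs_left_gt; rewrite oppr_lt0.
  exact: nbhs_left_lt.
have [cq|dq] := pselect (cvg (q @ 0^')); last exact: dvgP.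
rewrite (cvg_at_leftE _ _ cq); exact: cvg_lim.
Unshelve. all: by end_near. Qed.

Lemma derive1_eq0_right (f : R -> R) (a d : R) : 0 < d ->
  (forall b, a < b < a + d -> f b = f a) -> derive1 f a = 0.
Proof.
move=> d0 h; rewrite /derive1; set q := (fun h => _).
have q0 : q x @[x --> 0^'+] --> (0 : R).
  apply: (@cvg_trans _ (cst (0 : R) @ (0:R)^'+)); last exact: cvg_cst.
  apply: near_eq_cvg; rewrite /q; near=> e.
  rewrite /= h ?subrr ?scaler0 //.
  rewrite ltrDr addrC ltrD2l; apply/andP; split; near: e.
    exact: nbhs_right_gt.
  exact: nbhs_right_lt.
have [cq|dq] := pselect (cvg (q @ 0^')); last exact: dvgP.
rewrite (cvg_at_rightE _ _ cq); exact: cvg_lim.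
Unshelve. all: by end_near. Qed.

(** The derivative of [phi], with the value that [derive1] takes at the two kinks
1/2 and 1, where the limit does not exist. *)
Definition dphi (t : R) : R := if 2^-1 < t < 1 then - 2 else 0.

Lemma phi_le_half (t : R) : t <= 2^-1 -> phi t = 1.
Proof. by rewrite /phi => ->. Qed.

Lemma phi_ge1 (t : R) : 1 <= t -> phi t = 0.
Proof.
move=> t1; rewrite /phi; case: ifPn => [|_]; first by lra.
by case: ifPn => // ?; lra.
Qed.

Lemma phi_mid (t : R) : 2^-1 <= t <= 1 -> phi t = 2 - 2 * t.
Proof.
case/andP => h t1; rewrite /phi t1; case: ifPn => // h2.
have -> : t = 2^-1 by apply/le_anti/andP.
lra.
Qed.

Lemma phi_ge0 (t : R) : 0 <= phi t.
Proof. by rewrite /phi; case: ifPn => // ?; case: ifPn => // ?; lra. Qed.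

Lemma phi_le1 (t : R) : phi t <= 1.
Proof.
rewrite /phi; case: ifPn => // h1; case: ifPn => // h2.
by move: h1; rewrite -ltNge => h1; lra.
Qed.

Lemma derive1_phi (t : R) : derive1 phi t = dphi t.
Proof.
rewrite /dphi; have [h1|h1|->] := ltgtP t 2^-1.
- rewrite (@derive1_affine _ _ 1 0) //; near=> s.
  rewrite mul0r addr0 phi_le_half //; near: s; exact: lt_le_nbhsl.
- have [h2|h2|->] /= := ltgtP t 1.
  + rewrite (@derive1_affine _ _ 2 (- 2)) //; near=> s.
    rewrite phi_mid ?mulNr //; apply/andP; split; near: s.
      exact: lt_le_nbhsr.
    exact: lt_le_nbhsl.
  + rewrite (@derive1_affine _ _ 0 0) //; near=> s.
    rewrite mul0r addr0 phi_ge1 //; near: s; exact: lt_le_nbhsr.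
  + apply: (@derive1_eq0_right _ _ 1) => // b /andP[b1 _].
    by rewrite !phi_ge1 // ltW.
- rewrite /=; apply: (@derive1_eq0_left _ _ 1) => // b /andP[_ b1].
  by rewrite !phi_le_half // ltW.
Unshelve. all: by end_near. Qed.

Lemma phi_ge (t l : R) : 0 <= t -> t <= l -> l <= 1 -> Num.min 1 (2 * (1 - l)) <= phi t.
Proof.
move=> t0 tl l1; rewrite /phi; case: ifPn => h1; first by rewrite ge_min lexx.
rewrite (le_trans tl l1) ge_min; apply/orP; right; lra.
Qed.

(** Since |grad f| is bounded on the unit ball. *)
Lemma tilt_ge : exists2 c : R, 0 < c & forall t : R, t <= 1 -> c <= tilt t.
Proof.
have [K K0 kK] : exists2 K : R, 0 <= K & forall t, t <= 1 -> flat 2 t <= K.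
  exists ((2 + 2)%:R ^+ (2 + 2)) => [|t t1]; first exact: exprn_ge0.
  have [t0|t0] := leP t 0; first by rewrite flat_npos ?exprn_ge0.
  have := @flat_le R 2 2 t isT (ltW t0); move=> /le_trans; apply.
  by rewrite -[leRHS]mulr1 ler_wpM2l ?exprn_ge0 // exprn_ile1 // ltW.
have h0 : 0 < 1 + 4 * K ^+ 2 by rewrite ltr_wpDr // mulr_ge0 // sqr_ge0.
exists (Num.sqrt (1 + 4 * K ^+ 2))^-1; first by rewrite invr_gt0 sqrtr_gt0.
move=> t t1; have h := tilt_radicand_gt0 t.
rewrite /tilt lef_pV2 ?posrE ?sqrtr_gt0 // ler_wsqrtr // lerD2l.
have [t0|t0] := leP t 0.
  by rewrite flat_npos // expr0n /= mulr0 mulr_ge0 ?sqr_ge0.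
have k0 := flat_ge0 2 t.
rewrite -mulrA ler_wpM2l // -[leRHS]mul1r ler_pM // ?(ltW t0) ?sqr_ge0 //.
by rewrite lerXn2r ?nnegrE // kK.
Qed.

(** For t > 0 put u = 1 / t and E = exp(- u), so that [flat i t] is u^i E and the
integrand of 2 (D + L) is a polynomial in u, E and tau: the excess term is
8 u^3 E^2 tau.
By the identity tau = tau^3 (1 + 4 t k^2), with k = u^2 E, the divergence
satisfies - div(nu) = 2 m tau k + 4 t tau^3 (k' - 2 k^3) with
k' = (u^4 - 2 u^3) E, so that - f div(nu) is at most
E^2 tau (4 u^3 - 8 u^2 + 2 m u^2), because tau <= 1 and u >= m >= 2.  The
difference is at least 2 u^3 E^2 tau, again because u >= m. *)
Lemma integrand_ge (m : nat) (t : R) : (2 <= m)%N -> t <= m%:R^-1 ->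
  2 * (flat 0 t * flat 3 t * tilt t) <=
  2 * (1 - tilt t ^+ 2) / tilt t + @mean_curv R m t * flat 0 t.
Proof.
move=> m2 tm.
have c0 := tilt_gt0 t; have cn0 : tilt t != 0 by rewrite gt_eqF.
have sq := tilt_sq t.
have -> : 2 * (1 - tilt t ^+ 2) / tilt t = 8 * t * flat 2 t ^+ 2 * tilt t.
  have -> : 1 - tilt t ^+ 2 = 4 * t * flat 2 t ^+ 2 * tilt t ^+ 2.
    by rewrite -[X in X - _]sq; ring.
  by field.
have [t0|t0] := leP t 0.
  by rewrite !(flat_npos _ t0) !(mulr0, mul0r, expr0n) /= ?(mulr0, mul0r) ?addr0.
have e1 : flat 2 t * dtilt t + tilt t * (flat 4 t - 2 * flat 3 t) =
   tilt t ^+ 3 * ((flat 4 t - 2 * flat 3 t) - 2 * flat 2 t ^+ 3).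
  transitivity (flat 2 t * dtilt t +
    tilt t * (tilt t ^+ 2 * (1 + 4 * t * flat 2 t ^+ 2)) * (flat 4 t - 2 * flat 3 t)).
    by rewrite sq mulr1.
  by rewrite /dtilt; ring.
rewrite /mean_curv e1.
have um : m%:R <= t^-1.
  by rewrite -[leLHS]invrK lef_pV2 // posrE invr_gt0 ltr0n (leq_trans _ m2).
have m2' : 2 <= m%:R :> R by rewrite ler_nat.
rewrite !(flat_pos _ t0).
set E := expR _; set u := t^-1 in um *.
have E0 : 0 < E by exact: expR_gt0.
have u0 : 0 < u by rewrite invr_gt0.
set c := tilt t in c0 *.
have -> : t = u^-1 by rewrite invrK.
have c1 : c <= 1 by exact: tilt_le1.
have un0 : u != 0 by rewrite gt_eqF.
rewrite -subr_ge0.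
(* Every term on the right is a product of nonnegative factors. *)
have -> : 8 / u * (u ^+ 2 * E) ^+ 2 * c +
 - (m%:R * (2 * c * (u ^+ 2 * E)) +
  4 / u * (c ^+ 3 * (u ^+ 4 * E - 2 * (u ^+ 3 * E) - 2 * (u ^+ 2 * E) ^+ 3))) *
 (u ^+ 0 * E) - 2 * (u ^+ 0 * E * (u ^+ 3 * E) * c) =
 2 * (c * E ^+ 2 * u ^+ 2) * (u - m%:R) + 4 * (c * E ^+ 2 * u ^+ 2 * (u - 2)) * (1 - c ^+ 2)
  + 8 * (c * E ^+ 2 * u ^+ 2)
  + 8 * c ^+ 3 * (u ^+ 5 * E ^+ 4).
  field. by [].
have X0 : 0 <= c * E ^+ 2 * u ^+ 2 by rewrite !mulr_ge0 ?exprn_ge0 ?ltW.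
have u2 : 0 <= u - 2 by rewrite subr_ge0 (le_trans m2').
have c2 : 0 <= 1 - c ^+ 2 by rewrite subr_ge0 exprn_ile1 // ltW.
have Y0 : 0 <= c ^+ 3 * (u ^+ 5 * E ^+ 4) by rewrite !mulr_ge0 ?exprn_ge0 ?ltW.
have h1 := mulr_ge0 X0 (_ : 0 <= u - m%:R); have := h1; rewrite subr_ge0 => /(_ um) h1'.
have h2 := mulr_ge0 X0 u2; have h3 := mulr_ge0 h2 c2.
lra.
Qed.

Lemma flat0_mono (s t : R) : 0 < s -> s <= t -> flat 0 s <= flat 0 t.
Proof.
move=> s0 st; have t0 := lt_le_trans s0 st.
by rewrite !flat_pos // !expr0 !mul1r ler_expR lerN2 lef_pV2.
Qed.

(** Compares the height integrand at l x, with l = 1 + r^2, to the energy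
integrand at x, where t = |x|^2.  On the support of the former,
1 / t - 1 / (l^2 t) <= 12, so that f^2 changes by a factor at most exp 24; the
weight phi is at least 2 (1 - 1 / l) >= r^2; and t^-3 >= r^-6. *)
Lemma scaled_integrand_le (r l t c : R) : 0 < r -> r <= 1 -> l = 1 + r ^+ 2 ->
  0 < c -> c <= tilt t -> 0 < t ->
  r / 2 < l * Num.sqrt t -> l * Num.sqrt t < r ->
  flat 0 (l ^+ 2 * t) ^+ 2 * tilt (l ^+ 2 * t) / (l * Num.sqrt t) <=
  (2 * expR 24 / c) * r ^+ 3 * (flat 0 t * flat 3 t * tilt t * phi (Num.sqrt t / r)).
Proof.
move=> r0 r1 lE c0 ct t0 h1 h2.
have l1 : 1 < l by rewrite lE ltrDl exprn_gt0.
have l0 : 0 < l by lra.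
have s0 : 0 < Num.sqrt t by rewrite sqrtr_gt0.
set s := Num.sqrt t in h1 h2 s0 *.
have ts : t = s ^+ 2 by rewrite sqr_sqrtr // ltW.
have sr : s < r by rewrite (le_lt_trans _ h2) // ler_peMl // ltW.
have lt0 : 0 < l ^+ 2 * t by rewrite mulr_gt0 // exprn_gt0.
have f1 : flat 0 (l ^+ 2 * t) ^+ 2 <= expR 24 * flat 0 t ^+ 2.
  rewrite !flat_pos // !expr0 !mul1r -!expRM_natl -expRD ler_expR.
  have -> : (l ^+ 2 * t)^-1 = t^-1 - (l ^+ 2 - 1) / (l ^+ 2 * t).
    by field; rewrite !gt_eqF.
  suff : (l ^+ 2 - 1) / (l ^+ 2 * t) <= 12 by lra.
  rewrite ler_pdivrMr // ts -exprMn.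
  have : (r / 2) ^+ 2 <= (l * s) ^+ 2 by rewrite lerXn2r ?nnegrE ?divr_ge0 ?mulr_ge0 // ltW.
  have : l ^+ 2 - 1 <= 3 * r ^+ 2.
    rewrite lE.
    have r2 : 0 <= r ^+ 2 by exact: sqr_ge0.
    have r21 : r ^+ 2 <= 1 by rewrite exprn_ile1 // ltW.
    nra.
  rewrite expr_div_n; lra.
have f2 : flat 0 t <= r ^+ 6 * flat 3 t.
  rewrite -(mul_flat 0) -(mul_flat 1) -(mul_flat 2) !mulrA.
  rewrite ler_wpM2r ?flat_ge0 // -!expr2 -exprSr ts -exprM lerXn2r ?nnegrE ?ltW //.
have f3 : r ^+ 2 <= phi (s / r).
  have := @phi_ge (s / r) l^-1; have : s / r <= l^-1.
    by rewrite ler_pdivrMr // ler_pdivlMl // ltW.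
  move=> h /(_ _ h) h'; apply: le_trans (h' _ _); last 2 first.
  - by rewrite divr_ge0 // ltW.
  - by rewrite invf_le1 // ltW.
  have r21 : r ^+ 2 <= 1 by apply: exprn_ile1 => //; exact: ltW.
  rewrite le_min r21 /=.
  have -> : 1 - l^-1 = r ^+ 2 / l by rewrite lE; field; rewrite -lE gt_eqF.
  rewrite mulrCA -ler_pdivrMl ?exprn_gt0 // mulVf ?gt_eqF ?exprn_gt0 //.
  rewrite ler_pdivlMr // lE mul1r.
  lra.
have f4 : (l * s)^-1 <= 2 / r.
  by rewrite -[2 / r]invrK invf_div lef_pV2 ?posrE ?mulr_gt0 ?divr_gt0 ?invr_gt0 // ltW.
have f5 := tilt_le1 (l ^+ 2 * t).
have g0 := flat_ge0 0 t; have g3 := flat_ge0 3 t.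
apply: (@le_trans _ _ (expR 24 * (flat 0 t * (r ^+ 6 * flat 3 t)) * 1 * (2 / r))).
  apply: ler_pM => //.
  - by rewrite mulr_ge0 ?sqr_ge0 // ltW // tilt_gt0.
  - by rewrite invr_ge0 mulr_ge0 // ltW.
  apply: ler_pM => //; first exact: sqr_ge0.
    by rewrite ltW // tilt_gt0.
  by apply: le_trans f1 _; rewrite ler_wpM2l ?expR_ge0 // expr2 ler_wpM2l.
have -> : expR 24 * (flat 0 t * (r ^+ 6 * flat 3 t)) * 1 * (2 / r) =
  2 * expR 24 * r ^+ 3 * (flat 0 t * flat 3 t) * r ^+ 2.
  by field; rewrite gt_eqF.
have -> : 2 * expR 24 / c * r ^+ 3 * (flat 0 t * flat 3 t * tilt t * phi (s / r)) =
  2 * expR 24 * r ^+ 3 * (flat 0 t * flat 3 t) * (tilt t / c * phi (s / r)).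
  by ring.
rewrite ler_wpM2l //.
  have e24 := expR_ge0 (24 : R); have r3 : 0 <= r ^+ 3 by apply: exprn_ge0; exact: ltW.
  apply: mulr_ge0; last exact: mulr_ge0.
  by apply: mulr_ge0 => //; apply: mulr_ge0.
rewrite -[leLHS]mul1r ler_pM //; first exact: sqr_ge0.
by rewrite ler_pdivlMr // mul1r.
Qed.

End Estimates.

(** * The flat graph as a current *)
Section Current.
Context {R : realType} {m : nat}.
Hypothesis m0 : (0 < m)%N.

Lemma measurable_smooth_alg (f : 'rV[R]_m -> R) :
  smooth_alg f -> measurable_fun [set: 'rV[R]_m] f.
Proof. by move=> sf; apply: continuous_measurable_rV; exact: smooth_alg_continuous. Qed.

Lemma measurable_smooth_lsubmx (f : 'rV[R]_m -> R) :
  smooth_alg f -> measurable_fun [set: 'rV[R]_(m + 1)] (fun p => f (lsubmx p)).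
Proof.
move=> sf; apply: continuous_measurable_rV => p.
exact: (@smooth_lsubmx R m 1 setT f sf 0%N p).
Qed.

Lemma unit_ballE : @unit_ball R m = [set x | nsq x < 1].
Proof.
apply/funext => x; apply/propext; rewrite /unit_ball /= hsnorm_row.
by rewrite -[X in _ < X]sqrtr1 ltr_sqrt.
Qed.

Lemma measurable_unit_ball : measurable (@unit_ball R m).
Proof.
rewrite unit_ballE (_ : [set _ | _] = (@nsq R m) @^-1` `]-oo, 1[%classic).
  rewrite -[X in measurable X]setTI.
  by apply: measurable_smooth_alg => //; exact: SAnsq.
by apply/seteqP; split => x /=; rewrite in_itv.
Qed.

Lemma coord_sqr_le (x : 'rV[R]_m) j : x 0 j ^+ 2 <= nsq x.
Proof.
rewrite /nsq (bigD1 j) //= lerDl; apply: sumr_ge0 => k _; exact: sqr_ge0.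
Qed.

Lemma lebesgue_unit_ball : (lebesgue_rV R m (@unit_ball R m) < +oo)%E.
Proof.
have h11 : -1 <= 1 :> R by lra.
have [mc vc] := @lebesgue_cube R m _ _ h11.
apply: (@le_lt_trans _ _ (lebesgue_rV R m (cube (-1) 1))); last first.
  by rewrite vc ltry.
apply: le_measure; rewrite ?inE //; first exact: measurable_unit_ball.
rewrite unit_ballE => x /= x1 j; rewrite -ler_norml -[leRHS]sqrtr1 -sqrtr_sqr.
by rewrite ler_wsqrtr // (le_trans (coord_sqr_le x j)) // ltW.
Qed.

Lemma unit_frame_smooth i j : smooth_alg (fun x : 'rV[R]_m => unit_frame x i j).
Proof.
rewrite (_ : (fun _ => _) = fun x : 'rV[R]_m => (if val i == 0%N then tilt (nsq x) else 1) *
   row_mx 1%:M (flat_grad x)^T i j).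
  apply: SAmul; first by case: (\val i == 0%N); [exact: SAtilt|exact: SAcst].
  case: (split_ordP j) => k ->.
    rewrite (_ : (fun _ => _) = fun=> (1%:M : 'M[R]_m) i k); first exact: SAcst.
    by apply/funext => x; rewrite row_mxEl.
  rewrite (_ : (fun _ => _) = fun x : 'rV[R]_m => 2 * flat 2 (nsq x) * x 0 i).
    apply: SAmul; last exact: SAcoord.
    by apply: SAmul; [exact: SAcst|exact: SAflat].
  by apply/funext => x; rewrite row_mxEr !mxE ord1.
by apply/funext => x; rewrite /unit_frame mul_diag_mx !mxE.
Qed.

Definition orient_graph (p : 'rV[R]_(m + 1)) : 'M[R]_(m, m + 1) := unit_frame (lsubmx p).

Lemma measurable_orient_graph : measurable_fun setT orient_graph.
Proof.
apply/measurable_fun_matrixP => i j.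
exact: measurable_smooth_lsubmx (unit_frame_smooth i j).
Qed.

Definition gmap := graph_map (@flat_graph R m).

Lemma measurable_gmap : measurable_fun setT gmap.
Proof.
apply/measurable_fun_matrixP => i j; rewrite ord1; case: (split_ordP j) => k ->.
  rewrite (_ : (fun _ => _) = fun x : 'rV[R]_m => x 0 k).
    exact: measurable_entry.
  by apply/funext => x; rewrite /gmap /graph_map row_mxEl.
rewrite (_ : (fun _ => _) = @flat_graph R m).
  by apply: measurable_smooth_alg; exact: SAflat.
by apply/funext => x; rewrite /gmap /graph_map row_mxEr mxE ord1 eqxx mulr1n.
Qed.

Definition area (x : 'rV[R]_m) : R := (tilt (nsq x))^-1.

Lemma SAarea : smooth_alg (fun x : 'rV[R]_m => area x).
Proof.
rewrite (_ : (fun _ => _) =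
  fun x : 'rV[R]_m => (1 + 4 * nsq x * flat 2 (nsq x) ^+ 2) * tilt (nsq x)).
  apply: SAmul; last exact: SAtilt.
  apply: SAadd; first exact: SAcst.
  apply: SAmul; last by apply: SAexp; exact: SAflat.
  by apply: SAmul; [exact: SAcst|exact: SAnsq].
apply/funext => x; rewrite /area.
have c0 : tilt (nsq x) != 0 by rewrite gt_eqF // tilt_gt0.
apply: (mulfI c0); rewrite divff // -[LHS](tilt_sq (nsq x)); ring.
Qed.

Lemma measurable_area : measurable_fun setT area.
Proof. exact: measurable_smooth_alg SAarea. Qed.

Lemma area_ge0 x : 0 <= area x.
Proof. by rewrite invr_ge0 ltW // tilt_gt0. Qed.

Definition gmass : set 'rV[R]_(m + 1) -> \bar R :=
  wpush (lebesgue_rV R m) (@unit_ball R m) gmap area.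

Let gmass0 : gmass set0 = 0%E.
Proof. exact: wpush0. Qed.

Let gmass_ge0 A : (0 <= gmass A)%E.
Proof. by apply: wpush_ge0; exact: area_ge0. Qed.

Let gmass_sigma_additive : semi_sigma_additive gmass.
Proof.
apply: wpush_sigma_additive; [exact: measurable_unit_ball|exact: measurable_gmap|
  exact: measurable_area|exact: area_ge0].
Qed.

HB.instance Definition _ := isMeasure.Build _ _ _ gmass
  gmass0 gmass_ge0 gmass_sigma_additive.

Lemma area_bounded : exists2 K : R, 0 <= K & forall x, unit_ball x -> area x <= K.
Proof.
have [c c0 hc] := @tilt_ge R; exists c^-1; first by rewrite invr_ge0 ltW.
move=> x; rewrite unit_ballE /= => x1.
by rewrite lef_pV2 ?posrE ?tilt_gt0 // hc // ltW.
Qed.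

Let gmass_finite : fin_num_fun gmass.
Proof.
apply: lty_fin_num_fun; rewrite /gmass /wpush /=.
rewrite -[gmass _]/(wpush (lebesgue_rV R m) (@unit_ball R m) gmap area setT) /wpush.
rewrite (_ : @unit_ball R m `&` gmap @^-1` setT = @unit_ball R m); last exact: setIT.
have [K K0 hK] := area_bounded.
apply: (@le_lt_trans _ _ (\int[lebesgue_rV R m]_(x in @unit_ball R m) (cst K%:E x))%E).
  apply: ge0_le_integral => //.
  - exact: measurable_unit_ball.
  - by move=> x _; rewrite lee_fin area_ge0.
  - by apply/measurable_EFinP; apply: measurable_funTS; exact: measurable_area.
rewrite integral_cst; last exact: measurable_unit_ball.
by rewrite lte_mul_pinfty // lebesgue_unit_ball.
Qed.

HB.instance Definition _ := Measure_isFinite.Build _ _ _ gmass gmass_finite.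

Lemma gmass_outside : gmass (~` @cylinder R m) = 0%E.
Proof.
rewrite /gmass /wpush (_ : _ `&` _ = set0) ?integral_set0 //.
apply/seteqP; split => // x [x1]; rewrite /= /cylinder /=.
by rewrite /gmap /graph_map row_mxKl.
Qed.

Lemma orient_graph_unit : {ae gmass, forall p, mvnorm (orient_graph p) = 1}.
Proof. by apply: aeW => p; exact: mvnorm_unit_frame. Qed.

Definition graph_current : @current R m (m + 1) (@cylinder R m) :=
  Current gmass_outside measurable_orient_graph orient_graph_unit.

Lemma Rintegral_gmass (h : 'rV[R]_(m + 1) -> R) : measurable_fun setT h ->
  \int[gmass]_p h p = \int[lebesgue_rV R m]_(x in @unit_ball R m) (h (gmap x) * area x).
Proof.
move=> mh; rewrite /Rintegral; congr fine.
rewrite (@integral_wpush _ _ _ _ R (lebesgue_rV R m) (@unit_ball R m) gmap area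
  measurable_unit_ball measurable_gmap measurable_area area_ge0 gmass) //.
exact/measurable_EFinP.
Qed.

Lemma calib_graph p : calib p (orient_graph p) = 1.
Proof. exact: det_unit_frame_normal. Qed.

Lemma semicalibrated_graph : semicalibrated graph_current (@calib R m).
Proof. by apply: aeW => p; exact: calib_graph. Qed.

End Current.

(** * Measurability of forms along variable m-vectors *)
Section Multilinear.
Context {R : realType} {m n : nat}.

Definition set_row (A : 'M[R]_(m, n)) (i0 : 'I_m) (u : 'rV[R]_n) : 'M[R]_(m, n) :=
  \matrix_(i, j) if i == i0 then u 0 j else A i j.

Lemma row_set_row A i0 u : row i0 (set_row A i0 u) = u.
Proof. by apply/rowP => j; rewrite !mxE eqxx. Qed.

Lemma row'_set_row A i0 u : row' i0 (set_row A i0 u) = row' i0 A.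
Proof. by apply/matrixP => i j; rewrite !mxE eq_sym (negPf (neq_lift i0 i)). Qed.

Lemma mcovector_set_row_sum (alpha : 'M[R]_(m, n) -> R) A i0 (s : seq 'I_n) (a : 'I_n -> R) :
  mcovector alpha ->
  alpha (set_row A i0 (\sum_(j <- s) a j *: delta_mx 0 j)) =
  \sum_(j <- s) a j * alpha (set_row A i0 (delta_mx 0 j)).
Proof.
move=> [lin _]; elim: s => [|j s IH].
  rewrite !big_nil (lin _ (set_row A i0 0) (set_row A i0 0) i0 0 0) ?row'_set_row //.
    by rewrite !mul0r addr0.
  by rewrite !row_set_row !scale0r addr0.
rewrite !big_cons -IH.
rewrite (lin _ (set_row A i0 (delta_mx 0 j))
  (set_row A i0 (\sum_(j <- s) a j *: delta_mx 0 j)) i0 (a j) 1)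
  ?row'_set_row ?mul1r //.
by rewrite !row_set_row scale1r.
Qed.

(** By induction on the number k of rows of A p that may vary with p: the
expansion of one varying row in the standard basis leaves k - 1 of them. *)
Lemma measurable_mform (eta : @mform R m n) (A : 'rV[R]_n -> 'M[R]_(m, n)) :
  (forall p, mcovector (eta p)) ->
  (forall B, measurable_fun setT (fun p => eta p B)) ->
  measurable_fun setT A ->
  measurable_fun setT (fun p => eta p (A p)).
Proof.
move=> eta_cov eta_meas mA.
suff: forall k, (k <= m)%N -> forall (A : 'rV[R]_n -> 'M[R]_(m, n)),
   measurable_fun setT A ->
   (forall i : 'I_m, (k <= i)%N -> forall p, row i (A p) = row i (A 0)) ->
   measurable_fun setT (fun p => eta p (A p)).
  move=> /(_ m (leqnn m) A mA); apply => i.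
  by rewrite leqNgt ltn_ord.
elim=> [_|k IH km] B mB cB.
  rewrite (_ : (fun _ => _) = fun p => eta p (B 0)) //.
  apply/funext => p; congr (eta p); apply/row_matrixP => i; exact: cB.
pose i0 := Ordinal km.
rewrite (_ : (fun _ => _) = fun p =>
  \sum_(j : 'I_n) B p i0 j * eta p (set_row (B p) i0 (delta_mx 0 j))).
  apply: measurable_sum => j; apply: measurable_funM.
    by move/measurable_fun_matrixP : mB => /(_ i0 j).
  apply: IH; first exact: ltnW.
    apply/measurable_fun_matrixP => i l.
    have [ii0|ii0] := eqVneq i i0.
      rewrite (_ : (fun _ => _) = cst ((delta_mx 0 j : 'rV[R]_n) 0 l)); first exact: measurable_cst.
      by apply/funext => p; rewrite !mxE ii0 eqxx.
    rewrite (_ : (fun _ => _) = fun p => B p i l).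
      by move/measurable_fun_matrixP : mB => /(_ i l).
    by apply/funext => p; rewrite mxE (negPf ii0).
  move=> i ki p; apply/rowP => l; rewrite !mxE; case: eqVneq => // ii0.
  have ki' : (k < i)%N.
    rewrite ltn_neqAle ki andbT; apply: contra_neq ii0 => e; exact: val_inj.
  by move/rowP: (cB i ki' p) => /(_ l); rewrite !mxE.
apply/funext => p; rewrite -mcovector_set_row_sum //; congr (eta p).
apply/matrixP => i l; rewrite mxE; case: eqVneq => // ->.
transitivity (row i0 (B p) 0 l); first by rewrite mxE.
rewrite {1}(row_sum_delta (row i0 (B p))) !summxE; apply: eq_bigr => j _.
by rewrite !mxE.
Qed.

End Multilinear.


(** * The frequency of the flat graph *)
Section GraphCurrent.
Context {R : realType} {m : nat}.
Hypothesis m0 : (0 < m)%N.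

Lemma Ck_continuous n k (g : 'rV[R]_n -> R) : Ck k setT g -> continuous g.
Proof.
case: k => [h p|k [h _] p]; first exact: h.
by apply: differentiable_continuous; exact: h.
Qed.

(** The first row of the orienting frame carries the factor [tilt], which
cancels the area factor of the mass measure. *)
Lemma mcovector_frame (alpha : 'M[R]_(m, m + 1) -> R) (x : 'rV[R]_m) : mcovector alpha ->
  alpha (unit_frame x) = tilt (nsq x) * alpha ('J (graph_map (@flat_graph R m)) x).
Proof.
move=> [lin _]; rewrite jacobian_graph_map; set J := row_mx _ _.
rewrite (lin _ J J (Ordinal m0) (tilt (nsq x)) 0) ?mul0r ?addr0 //.
- rewrite scale0r addr0; apply/rowP => j.
  by rewrite /unit_frame mul_diag_mx !mxE eqxx.
- by apply/matrixP => i j; rewrite /unit_frame mul_diag_mx !mxE /= mul1r.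
- by apply/matrixP => i j; rewrite /unit_frame mul_diag_mx !mxE /= mul1r.
Qed.

Lemma is_graph_current_graph :
  is_graph_current (@flat_graph R m) (graph_current m0).
Proof.
exists false => eta [eta_smooth _]; rewrite expr0 mul1r /evaluate /=.
have eta_cov p : mcovector (eta p) by have [+ _] := eta_smooth 0%N; apply.
rewrite Rintegral_gmass; last first.
  apply: measurable_mform => //; last exact: measurable_orient_graph.
  move=> B; apply: continuous_measurable_rV.
  by have [_ /(_ B)] := eta_smooth 0%N; exact: Ck_continuous.
apply: eq_Rintegral => x _; rewrite /orient_graph /gmap {2}/graph_map row_mxKl.
rewrite mcovector_frame // /area mulrAC divff ?mul1r // gt_eqF //.
exact: tilt_gt0.
Qed.

Lemma freqD_integrand p :
  hsnorm (tangent_proj (graph_current m0) p - orthproj (@base_plane R m)) ^+ 2 =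
  2 * (1 - tilt (nsq (lsubmx p)) ^+ 2).
Proof. exact: tangent_tilt. Qed.

Lemma freqL_integrand p :
  Defs.contract (extd (@calib R m) p) (p *m (1%:M - orthproj (@base_plane R m)))
    (orient (graph_current m0) p) =
  @mean_curv R m (nsq (lsubmx p)) * (tilt (nsq (lsubmx p)) * (rsubmx p) 0 0).
Proof.
rewrite mul_orthproj_baseC extd_calib /= /orient_graph det_frame_vert //.
Qed.

(** At points with x = 0, where |x| is not differentiable, both sides vanish
because phi is constant near 0. *)
Lemma freqH_integrand p r :
  dist_plane (@base_plane R m) p ^+ 2 *
   (hsnorm (tangent_gradient (graph_current m0) (proj_norm (@base_plane R m)) p) ^+ 2 /
     proj_norm (@base_plane R m) p) *
   derive1 phi (proj_norm (@base_plane R m) p / r) =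
  nsq (rsubmx p) * (tilt (nsq (lsubmx p)) ^+ 2 / Num.sqrt (nsq (lsubmx p))) *
    dphi (Num.sqrt (nsq (lsubmx p)) / r).
Proof.
rewrite derive1_phi dist_base_plane proj_norm_base.
have [x0|x0] := eqVneq (nsq (lsubmx p)) 0.
  rewrite x0 sqrtr0 mul0r /dphi; case: ifPn; last by rewrite !mulr0.
  by case/andP; lra.
have {}x0 : 0 < nsq (lsubmx p) by rewrite lt0r x0 nsq_ge0.
rewrite hsnorm_sqr_row /tangent_gradient gradient_proj_norm //.
by rewrite [tangent_proj _ _]/(orthproj (unit_frame (lsubmx p))) nsq_tangent_radial.
Qed.

Lemma nsq_rV1 (y : 'rV[R]_1) : nsq y = y 0 0 ^+ 2.
Proof. by rewrite /nsq big_ord1. Qed.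

Lemma gmapl x : lsubmx (gmap x) = x :> 'rV[R]_m.
Proof. by rewrite /gmap /graph_map row_mxKl. Qed.

Lemma gmapr (x : 'rV[R]_m) : rsubmx (gmap x) 0 0 = flat 0 (nsq x).
Proof. by rewrite /gmap /graph_map row_mxKr mxE eqxx mulr1n. Qed.

Lemma measurable_phi : measurable_fun [set: R] (@phi R).
Proof.
rewrite (_ : phi = fun t : R => Num.min 1 (Num.max (2 - 2 * t) 0)).
  apply: measurable_minr => //; apply: measurable_maxr => //.
  by apply: measurable_funB => //; apply: measurable_funM.
apply/funext => t; rewrite /phi; case: ifPn => h1.
  by rewrite min_l // le_max; apply/orP; left; lra.
move: h1; rewrite -ltNge => h1; case: ifPn => h2.
  by rewrite max_l ?min_r //; lra.
by move: h2; rewrite -ltNge => h2; rewrite max_r ?min_r //; lra.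
Qed.

Local Notation mu := (lebesgue_rV R m).
Local Notation B1 := (@unit_ball R m).

Lemma measurable_radial (u : R -> R) : measurable_fun setT u ->
  measurable_fun [set: 'rV[R]_m] (fun x => u (Num.sqrt (nsq x))).
Proof.
move=> mu_; apply: measurableT_comp => //.
have ms : measurable_fun [set: R] (Num.sqrt : R -> R).
  by apply: continuous_measurable_fun; exact: sqrt_continuous.
exact: (measurableT_comp ms (measurable_smooth_alg (SAnsq m))).
Qed.

Lemma measurable_lsubmx : measurable_fun setT (lsubmx : 'rV[R]_(m + 1) -> 'rV[R]_m).
Proof.
apply/measurable_fun_matrixP => i j; rewrite ord1.
exact: measurable_smooth_lsubmx (SAcoord j).
Qed.

Lemma measurable_rsubmx00 : measurable_fun setT (fun p : 'rV[R]_(m + 1) => rsubmx p 0 0).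
Proof.
rewrite (_ : (fun _ => _) = fun p : 'rV[R]_(m + 1) => p 0 (rshift m 0)).
  exact: measurable_entry.
by apply/funext => p; rewrite mxE.
Qed.

Definition cut (r : R) (x : 'rV[R]_m) : R := phi (Num.sqrt (nsq x) / r).

Lemma measurable_cut r : measurable_fun setT (cut r).
Proof.
apply: (measurable_radial (u := fun s => phi (s / r))).
by apply: measurableT_comp; [exact: measurable_phi|exact: measurable_funM].
Qed.

Definition tilt_excess (x : 'rV[R]_m) : R := 2 * (1 - tilt (nsq x) ^+ 2).

Lemma SAtilt_excess : smooth_alg tilt_excess.
Proof.
apply: SAmul; first exact: SAcst.
apply: SAadd; first exact: SAcst.
by apply: SAopp; apply: SAexp; exact: SAtilt.
Qed.

Lemma SAmean_curv : smooth_alg (fun x : 'rV[R]_m => @mean_curv R m (nsq x)).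
Proof.
have sk i : smooth_alg (fun x : 'rV[R]_m => flat i (nsq x)) by exact: SAflat.
have st : smooth_alg (fun x : 'rV[R]_m => tilt (nsq x)) by exact: SAtilt.
have sn : smooth_alg (fun x : 'rV[R]_m => nsq x) by exact: SAnsq.
have sc c : smooth_alg (fun _ : 'rV[R]_m => c) by exact: SAcst.
have sd : smooth_alg (fun x : 'rV[R]_m => flat 4 (nsq x) - 2 * flat 3 (nsq x)).
  by apply: SAadd => //; apply/SAopp/SAmul.
have sdt : smooth_alg (fun x : 'rV[R]_m => dtilt (nsq x)).
  apply: SAmul; last exact: SAexp.
  apply/SAopp/SAadd; first by apply: SAmul => //; exact: SAexp.
  by repeat apply: SAmul => //.
apply/SAopp/SAadd; first by repeat apply: SAmul => //.
apply: SAmul; first exact: SAmul.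
by apply: SAadd; apply: SAmul.
Qed.

Lemma freqDE r : freqD (@base_plane R m) (graph_current m0) r =
  (2 * r ^+ (m - 2))^-1 *
    \int[mu]_(x in B1) (tilt_excess x * area x * cut r x).
Proof.
rewrite /freqD; congr (_ * _).
rewrite (_ : (fun p => _) = fun p => tilt_excess (lsubmx p) * cut r (lsubmx p)); last first.
  by apply/funext => p; rewrite freqD_integrand proj_norm_base.
rewrite Rintegral_gmass; last first.
  apply: measurable_funM; first exact: (measurable_smooth_lsubmx SAtilt_excess).
  exact: (measurableT_comp (measurable_cut r) measurable_lsubmx).
by apply: eq_Rintegral => x _; rewrite gmapl mulrAC.
Qed.

Lemma freqLE r : freqL (@base_plane R m) (graph_current m0) (@calib R m) r =
  (2 * r ^+ (m - 2))^-1 *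
    \int[mu]_(x in B1) (@mean_curv R m (nsq x) * flat 0 (nsq x) * cut r x).
Proof.
rewrite /freqL; congr (_ * _).
rewrite (_ : (fun p => _) = fun p : 'rV[R]_(m + 1) => @mean_curv R m (nsq (lsubmx p)) *
   (tilt (nsq (lsubmx p)) * rsubmx p 0 0) * cut r (lsubmx p)); last first.
  by apply/funext => p; rewrite freqL_integrand proj_norm_base.
rewrite Rintegral_gmass; last first.
  apply: measurable_funM; last exact: (measurableT_comp (measurable_cut r) measurable_lsubmx).
  apply: measurable_funM; first exact: (measurable_smooth_lsubmx SAmean_curv).
  apply: measurable_funM; first exact: (measurable_smooth_lsubmx (SAtilt _)).
  exact: measurable_rsubmx00.
apply: eq_Rintegral => x _; rewrite gmapl gmapr /area.
have c0 : tilt (nsq x) != 0 by rewrite gt_eqF // tilt_gt0.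
by field.
Qed.

Definition height_density (r : R) (x : 'rV[R]_m) : R :=
  flat 0 (nsq x) ^+ 2 * tilt (nsq x) / Num.sqrt (nsq x) *
  (\1_(`]2^-1, 1[%classic) (Num.sqrt (nsq x) / r)).

Lemma dphiE (t : R) : dphi t = - 2 * \1_(`]2^-1, 1[%classic) t.
Proof.
rewrite /dphi indicE; case: ifPn => h; first by rewrite mem_set ?mulr1 //= in_itv.
by rewrite memNset ?mulr0 //= in_itv; exact/negP.
Qed.

Lemma measurable_height_density r : measurable_fun setT (height_density r).
Proof.
apply: measurable_funM.
  apply: measurable_funM; last first.
    rewrite (_ : (fun _ => _) = fun x : 'rV[R]_m => Num.sqrt (nsq x) `^ (- 1)).
      apply: (measurable_radial (u := fun s => s `^ (- 1))); exact: measurable_powR.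
    by apply/funext => x; rewrite powR_inv1 // sqrtr_ge0.
  apply: measurable_smooth_alg; apply: SAmul; last exact: SAtilt.
  by apply: SAexp; exact: SAflat.
apply: (measurable_radial (u := fun s => \1_(`]2^-1, 1[%classic) (s / r))).
by apply: measurableT_comp; [exact: measurable_indic|exact: measurable_funM].
Qed.


Lemma integrable_bounded (h : 'rV[R]_m -> R) (K : R) :
  measurable_fun setT h -> (forall x, unit_ball x -> `|h x| <= K) ->
  mu.-integrable B1 (EFin \o h).
Proof.
move=> mh hK; apply: measurable_bounded_integrable => //.
- exact: measurable_unit_ball.
- exact: lebesgue_unit_ball.
- exact: measurable_funTS.
- exists K; split; first exact: num_real.
  by move=> M KM x x1; exact: (le_trans (hK x x1) (ltW KM)).
Qed.

Lemma cut_norm_le1 r x : `|cut r x| <= 1.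
Proof. by rewrite ger0_norm ?phi_ge0 // phi_le1. Qed.

Lemma flat_le_unit i : exists2 K : R, 0 <= K & forall t, t <= 1 -> flat i t <= K.
Proof.
exists ((i + 1)%:R ^+ (i + 1)) => [|t t1]; first exact: exprn_ge0.
have [t0|t0] := leP t 0; first by rewrite flat_npos ?exprn_ge0.
have := @flat_le R i 1 t _ (ltW t0); rewrite addn1 => /(_ isT) /le_trans; apply.
by rewrite expr1 -[leRHS]mulr1 ler_wpM2l ?exprn_ge0.
Qed.

(** By induction on the generators: the flat functions are bounded on (- oo, 1]
by [flat_le]. *)
Lemma smooth_alg_bounded (h : 'rV[R]_m -> R) : smooth_alg h ->
  exists K : R, forall x, unit_ball x -> `|h x| <= K.
Proof.
elim=> [c|j|i||g1 g2 _ [K1 h1] _ [K2 h2]|g1 g2 _ [K1 h1] _ [K2 h2]].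
- by exists `|c|.
- exists 1 => x; rewrite unit_ballE /= => x1.
  rewrite -[leRHS]sqrtr1 -sqrtr_sqr ler_wsqrtr //.
  by rewrite (le_trans (coord_sqr_le x j)) // ltW.
- have [K K0 hK] := flat_le_unit i; exists K => x; rewrite unit_ballE /= => x1.
  by rewrite ger0_norm ?flat_ge0 // hK // ltW.
- exists 1 => x _; rewrite ger0_norm ?tilt_le1 //; exact: ltW (tilt_gt0 _).
- exists (K1 + K2) => x x1; rewrite (le_trans (ler_normD _ _)) // lerD ?h1 ?h2 //.
- by exists (K1 * K2) => x x1; rewrite normrM ler_pM ?h1 ?h2.
Qed.

Lemma integrable_smooth_cut (h : 'rV[R]_m -> R) r : smooth_alg h ->
  mu.-integrable B1 (EFin \o (fun x => h x * cut r x)).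
Proof.
move=> sh; have [K hK] := smooth_alg_bounded sh.
apply: (@integrable_bounded _ K).
  by apply: measurable_funM; [exact: measurable_smooth_alg|exact: measurable_cut].
move=> x x1; rewrite normrM -[K]mulr1 ler_pM //; first exact: hK.
exact: cut_norm_le1.
Qed.

(** The function |x|^-6 f^2 tau. *)
Definition energy_density (x : 'rV[R]_m) : R :=
  flat 0 (nsq x) * flat 3 (nsq x) * tilt (nsq x).

Lemma SAenergy : smooth_alg energy_density.
Proof.
by apply: SAmul; last exact: SAtilt; apply: SAmul; exact: SAflat.
Qed.

Lemma energy_density_ge0 x : 0 <= energy_density x.
Proof. by rewrite /energy_density !mulr_ge0 ?flat_ge0 // ltW // tilt_gt0. Qed.

Lemma freqGamma_ge (r : R) : (2 <= m)%N -> 0 < r -> r <= m%:R^-1 ->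
  r ^- (m - 2) * \int[mu]_(x in B1) (energy_density x * cut r x) <=
  freqGamma (@base_plane R m) (graph_current m0) (@calib R m) r.
Proof.
move=> m2 r0 rm; rewrite /freqGamma freqDE freqLE -mulrDr.
have sD : smooth_alg (fun x => tilt_excess x * area x).
  by apply: SAmul; [exact: SAtilt_excess|exact: SAarea].
have sL : smooth_alg (fun x : 'rV[R]_m => @mean_curv R m (nsq x) * flat 0 (nsq x)).
  by apply: SAmul; [exact: SAmean_curv|exact: SAflat].
have iD := integrable_smooth_cut r sD; have iL := integrable_smooth_cut r sL.
have mB := @measurable_unit_ball R m.
rewrite -RintegralD // invfM -mulrA mulrCA ler_wpM2l //.
  by rewrite invr_ge0 exprn_ge0 // ltW.
have iE := integrable_smooth_cut r SAenergy.
rewrite ler_pdivlMl // -RintegralZl //.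
apply: le_Rintegral => //.
- have := integrable_smooth_cut r (SAmul (SAcst _ 2) SAenergy).
  by apply: eq_integrable => // x _ /=; rewrite mulrA.
- have := integrable_smooth_cut r (SAadd sD sL).
  by apply: eq_integrable => // x _ /=; rewrite mulrDl.
move=> x _; rewrite -mulrDl mulrA.
have [xr|xr] := leP r (Num.sqrt (nsq x)).
  by rewrite /cut phi_ge1 ?mulr0 // ler_pdivlMr // mul1r.
rewrite ler_wpM2r ?phi_ge0 //.
apply: integrand_ge => //.
have s0 := sqrtr_ge0 (nsq x).
rewrite -[nsq x]sqr_sqrtr ?nsq_ge0 //.
apply: (@le_trans _ _ (Num.sqrt (nsq x))).
  rewrite expr2 -[leRHS]mulr1 ler_wpM2l // (le_trans (ltW xr)) // (le_trans rm) //.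
  by rewrite invf_le1 ?ler1n ?ltr0n.
exact: le_trans (ltW xr) rm.
Qed.

Lemma height_density_ge0 r x : 0 <= height_density r x.
Proof.
rewrite /height_density; apply: mulr_ge0; last by rewrite indicE ler0n.
apply: divr_ge0; last exact: sqrtr_ge0.
by apply: mulr_ge0; [exact: sqr_ge0|exact: ltW (tilt_gt0 _)].
Qed.

Lemma integrable_height (r : R) : 0 < r -> mu.-integrable B1 (EFin \o height_density r).
Proof.
move=> r0; have [K K0 hK] := flat_le_unit 0.
apply: (@integrable_bounded _ (K ^+ 2 * (2 / r))); first exact: measurable_height_density.
move=> x; rewrite unit_ballE /= => x1; rewrite ger0_norm ?height_density_ge0 //.
rewrite /height_density indicE.
have [h|h] := pselect ((`]2^-1, 1[%classic : set R) (Num.sqrt (nsq x) / r)); last first.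
  by rewrite memNset // mulr0 mulr_ge0 ?sqr_ge0 // divr_ge0 // ltW.
rewrite mem_set // mulr1; move: h; rewrite /= in_itv /= => /andP[h1 _].
have s0 : 0 < Num.sqrt (nsq x).
  rewrite lt0r sqrtr_ge0 andbT; apply/negP => /eqP s0.
  by move: h1; rewrite s0 mul0r; lra.
rewrite ler_pM ?invr_ge0 //.
- by rewrite mulr_ge0 ?sqr_ge0 // ltW // tilt_gt0.
- rewrite -[leRHS]mulr1 ler_pM ?sqr_ge0 ?tilt_le1 ?(ltW (tilt_gt0 _)) //.
  by rewrite lerXn2r ?nnegrE ?flat_ge0 // hK // ltW.
- rewrite -[2 / r]invrK invf_div lef_pV2 ?posrE ?divr_gt0 // ltW //.
  by move: h1; rewrite ltr_pdivlMr // mulrC.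
Qed.

(** The height density without the factor f^2 and the area factor; it does not
involve the vertical variable. *)
Definition slope_density (r : R) (x : 'rV[R]_m) : R :=
  tilt (nsq x) ^+ 2 * (Num.sqrt (nsq x))^-1 *
    \1_(`]2^-1, 1[%classic) (Num.sqrt (nsq x) / r).

Lemma measurable_slope_density r : measurable_fun setT (slope_density r).
Proof.
apply: measurable_funM.
  apply: measurable_funM; last first.
    rewrite (_ : (fun _ => _) = fun x : 'rV[R]_m => Num.sqrt (nsq x) `^ (- 1)).
      apply: (measurable_radial (u := fun s => s `^ (- 1))); exact: measurable_powR.
    by apply/funext => x; rewrite powR_inv1 // sqrtr_ge0.
  by apply: measurable_smooth_alg; apply: SAexp; exact: SAtilt.
apply: (measurable_radial (u := fun s => \1_(`]2^-1, 1[%classic) (s / r))).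
by apply: measurableT_comp; [exact: measurable_indic|exact: measurable_funM].
Qed.

Lemma freqHE (r : R) : 0 < r -> freqH (@base_plane R m) (graph_current m0) r =
  2 * r ^- (m - 1) * \int[mu]_(x in B1) height_density r x.
Proof.
move=> r0; rewrite /freqH.
rewrite (_ : (fun p => _) = fun p : 'rV[R]_(m + 1) => - 2 * ((rsubmx p) 0 0 ^+ 2 *
   slope_density r (lsubmx p))); last first.
  apply/funext => p; rewrite freqH_integrand dphiE nsq_rV1 /slope_density; ring.
rewrite Rintegral_gmass; last first.
  apply: measurable_funM => //; apply: measurable_funM.
    by apply: measurable_funX; exact: measurable_rsubmx00.
  exact: (measurableT_comp (measurable_slope_density r) measurable_lsubmx).
transitivity (- (r ^- (m - 1) * (- 2 * \int[mu]_(x in B1) height_density r x))); last by ring.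
congr (- (_ * _)); rewrite -RintegralZl //.
- apply: eq_Rintegral => x _; rewrite gmapl gmapr /area /height_density /slope_density.
  have c0 : tilt (nsq x) != 0 by rewrite gt_eqF // tilt_gt0.
  set q := (Num.sqrt _)^-1; set i := \1_ _ _; by field.
- exact: measurable_unit_ball.
- exact: integrable_height.
Qed.

Lemma integral_ball_extend (h : 'rV[R]_m -> R) : (forall x, ~ unit_ball x -> h x = 0) ->
  (\int[mu]_(x in B1) (h x)%:E = \int[mu]_x (h x)%:E)%E.
Proof.
move=> h0; rewrite integral_mkcond; apply: eq_integral => x _; rewrite patchE.
by case: ifPn => //; rewrite notin_setE => /h0 ->.
Qed.

(** The comparison by dilation: integrate [scaled_integrand_le], after the change
of variables x |-> (1 + r^2) x.  The factor 2 ^+ m bounds its Jacobian. *)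
Lemma height_le_energy : exists2 C : R, 0 < C & forall r : R, 0 < r -> r < 1 ->
  \int[mu]_(x in B1) height_density r x <=
  C * r ^+ 3 * \int[mu]_(x in B1) (energy_density x * cut r x).
Proof.
have [c c0 hc] := @tilt_ge R.
pose K := 2 * expR 24 / c.
have K0 : 0 < K by rewrite divr_gt0 // mulr_gt0 // expR_gt0.
exists (2 ^+ m * K); first by rewrite mulr_gt0 // exprn_gt0.
move=> r r0 r1; pose l := 1 + r ^+ 2.
have l0 : 0 < l by rewrite ltr_pwDl // sqr_ge0.
have outside (x : 'rV[R]_m) : ~ unit_ball x -> 1 <= Num.sqrt (nsq x) / r.
  rewrite unit_ballE /= => /negP; rewrite -leNgt => x1.
  rewrite ler_pdivlMr // mul1r (le_trans (ltW r1)) // -[leLHS]sqrtr1.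
  by rewrite ler_wsqrtr.
have hE : (\int[mu]_(x in B1) (height_density r x)%:E = \int[mu]_x (height_density r x)%:E)%E.
  apply: integral_ball_extend => x /outside x1; rewrite /height_density indicE.
  rewrite memNset ?mulr0 //= in_itv /= => /andP[_]; rewrite ltNge x1 //.
have eE : (\int[mu]_(x in B1) (energy_density x * cut r x)%:E =
           \int[mu]_x (energy_density x * cut r x)%:E)%E.
  by apply: integral_ball_extend => x /outside x1; rewrite /cut phi_ge1 // mulr0.
have mh : measurable_fun [set: 'rV[R]_m] (fun x => (height_density r x)%:E).
  by apply/measurable_EFinP; exact: measurable_height_density.
have me : measurable_fun [set: 'rV[R]_m] (fun x => (energy_density x * cut r x)%:E).
  apply/measurable_EFinP; apply: measurable_funM; last exact: measurable_cut.
  by apply: measurable_smooth_alg; exact: SAenergy.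
have h0 x : (0 <= (height_density r x)%:E)%E by rewrite lee_fin height_density_ge0.
have e0 x : 0 <= energy_density x * cut r x.
  by rewrite mulr_ge0 ?energy_density_ge0 // phi_ge0.
have key : (\int[mu]_(x in B1) (height_density r x)%:E <=
   (2 ^+ m * K * r ^+ 3)%:E * \int[mu]_(x in B1) (energy_density x * cut r x)%:E)%E.
  rewrite hE eE.
  have := integral_scale_rV l0 mh h0.
  move/(congr1 (fun z => (l ^+ m)%:E * z)%E).
  rewrite muleA -EFinM -exprMn divff ?gt_eqF // expr1n mul1e => <-.
  have lm : l ^+ m <= 2 ^+ m.
    rewrite lerXn2r ?nnegrE // ?(ltW l0) // /l.
    have : r ^+ 2 <= 1 by apply: exprn_ile1; exact: ltW.
    lra.
  rewrite -mulrA EFinM -muleA; apply: lee_pmul.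
  - by rewrite lee_fin exprn_ge0 // ltW.
  - by apply: integral_ge0 => x _.
  - by rewrite lee_fin.
  have Kr : 0 <= K * r ^+ 3 by rewrite mulr_ge0 ?(ltW K0) // exprn_ge0 // ltW.
  rewrite -ge0_integralZl //; last by move=> x _; rewrite lee_fin.
  apply: ge0_le_integral => //.
  - apply: (measurableT_comp mh); exact: measurable_scale_rV.
  - by apply: emeasurable_funM.
  move=> y _; rewrite -EFinM lee_fin {1}/height_density indicE.
  have sl : Num.sqrt (nsq (l *: y)) = l * Num.sqrt (nsq y).
    by rewrite nsqZ sqrtrM ?sqr_ge0 // sqrtr_sqr ger0_norm // ltW.
  rewrite sl nsqZ.
  have [h|h] := pselect ((`]2^-1, 1[%classic : set R) (l * Num.sqrt (nsq y) / r)); last first.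
    by rewrite memNset // mulr0 mulr_ge0.
  rewrite mem_set // mulr1; move: h; rewrite /= in_itv /= => /andP[].
  rewrite ltr_pdivlMr // ltr_pdivrMr // mul1r => h1 h2.
  have s0 : 0 < Num.sqrt (nsq y).
    by rewrite -(pmulr_rgt0 _ l0) (lt_trans _ h1) // mulr_gt0 // invr_gt0.
  have t0 : 0 < nsq y by rewrite -sqrtr_gt0.
  apply: scaled_integrand_le => //; first exact: ltW.
    apply: hc; rewrite -[leRHS](expr1n _ 2) -[nsq y]sqr_sqrtr ?nsq_ge0 //.
    rewrite lerXn2r ?nnegrE ?(ltW s0) //.
    rewrite (le_trans _ (ltW r1)) // (le_trans _ (ltW h2)) // ler_peMl ?(ltW s0) //.
    by rewrite /l lerDl sqr_ge0.
  by rewrite mulrC.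
have iE := integrable_smooth_cut r SAenergy.
have iH := integrable_height r0.
have mB := @measurable_unit_ball R m.
rewrite -lee_fin EFinM.
rewrite /Rintegral !fineK //; [exact: integrable_fin_num iE|exact: integrable_fin_num iH].
Qed.

(** The annulus r/2 < |x| < r contains the cube whose sides are the intervals
between 3/5 and 4/5 of r / sqrt m, where the integrand is bounded below. *)
Lemma height_gt0 (r : R) : 0 < r -> r < 1 ->
  0 < \int[mu]_(x in B1) height_density r x.
Proof.
move=> r0 r1.
have iH := integrable_height r0; have mB := @measurable_unit_ball R m.
have [c c0 hc] := @tilt_ge R.
have mR : 0 < Num.sqrt m%:R :> R by rewrite sqrtr_gt0 ltr0n.
pose a := 3 / 5 * r / Num.sqrt m%:R; pose b := 4 / 5 * r / Num.sqrt m%:R.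
have a0 : 0 < a by rewrite !mulr_gt0 ?invr_gt0.
have ab : a < b by rewrite ltr_pM2r ?invr_gt0 // ltr_pM2r //; lra.
have am : m%:R * a ^+ 2 = (3 / 5 * r) ^+ 2.
  by rewrite [(_ / Num.sqrt _) ^+ 2]expr_div_n sqr_sqrtr // mulrC divfK // gt_eqF // ltr0n.
have bm : m%:R * b ^+ 2 = (4 / 5 * r) ^+ 2.
  by rewrite [(_ / Num.sqrt _) ^+ 2]expr_div_n sqr_sqrtr // mulrC divfK // gt_eqF // ltr0n.
have [mc vc] := @lebesgue_cube R m _ _ (ltW ab).
pose d := flat 0 (r ^+ 2 / 4) ^+ 2 * c / r.
have d0 : 0 < d.
  by rewrite divr_gt0 // mulr_gt0 // exprn_gt0 // flat_gt0 // divr_gt0 // exprn_gt0.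
have cubeP (x : 'rV[R]_m) : cube a b x -> r / 2 < Num.sqrt (nsq x) < r.
  move=> hx.
  have l1 : m%:R * a ^+ 2 <= nsq x.
    rewrite -[m in m%:R]card_ord mulr_natl -sumr_const; apply: ler_sum => j _.
    by have /andP[h _] := hx j; rewrite lerXn2r ?nnegrE ?(ltW a0) // (le_trans (ltW a0)).
  have l2 : nsq x <= m%:R * b ^+ 2.
    rewrite -[m in m%:R]card_ord mulr_natl -sumr_const; apply: ler_sum => j _.
    have /andP[h h'] := hx j.
    by rewrite lerXn2r ?nnegrE // ?(le_trans (ltW a0)) // ltW.
  have r2 : 0 < r ^+ 2 by rewrite exprn_gt0.
  have ra (y : R) : 0 <= y -> y = Num.sqrt (y ^+ 2) by move=> y0; rewrite sqrtr_sqr ger0_norm.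
  rewrite am exprMn in l1; rewrite bm exprMn in l2.
  have t0 : 0 < nsq x by rewrite (lt_le_trans _ l1) // mulr_gt0 // exprn_gt0.
  apply/andP; split.
    rewrite [ltLHS]ra ?divr_ge0 ?(ltW r0) // ltr_sqrt // expr_div_n; lra.
  rewrite [ltRHS]ra ?(ltW r0) // ltr_sqrt //; lra.
have cubeB (x : 'rV[R]_m) : cube a b x -> B1 x.
  by move=> /cubeP /andP[_ h]; rewrite unit_ballE /= -ltr_sqrt // sqrtr1 (lt_trans h).
have low : (\int[mu]_(x in cube a b) (cst d%:E x) <= \int[mu]_(x in B1) (height_density r x)%:E)%E.
  apply: (@le_trans _ _ (\int[mu]_(x in cube a b) (height_density r x)%:E)%E); last first.
    apply: ge0_subset_integral => //.
    - apply/measurable_EFinP; apply: measurable_funTS; exact: measurable_height_density.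
    - by move=> x _; rewrite lee_fin height_density_ge0.
  apply: ge0_le_integral => //.
  - by move=> x _; rewrite lee_fin ltW.
  - apply/measurable_EFinP; apply: measurable_funTS; exact: measurable_height_density.
  move=> x hx; have /andP[h1 h2] := cubeP x hx; rewrite lee_fin /height_density indicE.
  have s0 : 0 < Num.sqrt (nsq x) by rewrite (lt_trans _ h1) // divr_gt0.
  rewrite mem_set ?mulr1; last first.
    by rewrite /= in_itv /= ltr_pdivlMr // ltr_pdivrMr // mul1r h2 mulrC h1.
  rewrite /d ler_pM //.
  - by rewrite mulr_ge0 ?sqr_ge0 // ltW.
  - by rewrite invr_ge0 ltW.
  - rewrite ler_pM ?sqr_ge0 ?(ltW c0) //.
      rewrite lerXn2r ?nnegrE ?flat_ge0 // flat0_mono ?divr_gt0 ?exprn_gt0 //.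
      rewrite -[nsq x]sqr_sqrtr ?nsq_ge0 // (_ : r ^+ 2 / 4 = (r / 2) ^+ 2); last by field.
      by rewrite lerXn2r ?nnegrE ?divr_ge0 ?(ltW r0) ?(ltW s0) // ltW.
    by apply: hc; have := cubeB x hx; rewrite unit_ballE => /ltW.
  - by rewrite lef_pV2 ?posrE // ltW.
rewrite -lte_fin /Rintegral fineK; last exact: integrable_fin_num iH.
apply: lt_le_trans low.
rewrite integral_cst //; apply: mule_gt0; first by rewrite lte_fin.
suff : (0 < mu (cube a b))%E by [].
by rewrite vc lte_fin exprn_gt0 // subr_gt0.
Qed.

End GraphCurrent.

(** * Divergence of the frequency *)
Theorem theorem18p2 (R : realType) (m : nat) (hm : (2 <= m)%N) :
  exists (f : 'rV[R]_m -> R) (T : @current R m (m + 1) (@cylinder R m))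
         (omega : @mform R m (m + 1)),
    [/\ smooth (@unit_ball R m) f,
        radial f,
        is_graph_current f T,
        semicalibration (@cylinder R m) omega /\ semicalibrated T omega &
        (exists r0 : R, 0 < r0 /\
           forall r : R, 0 < r < r0 -> 0 < freqH (@base_plane R m) T r) /\
        freqN (@base_plane R m) T omega r @[r --> 0^'+] --> +oo].
Proof.
have m0 : (0 < m)%N by exact: leq_trans hm.
exists (@flat_graph R m), (graph_current m0), (@calib R m).
have hH (r : R) : 0 < r < 1 -> 0 < freqH (@base_plane R m) (graph_current m0) r.
  case/andP => r0 r1; rewrite freqHE //; apply: mulr_gt0; last exact: height_gt0.
  by rewrite mulr_gt0 // invr_gt0 exprn_gt0.
split.
- by apply: smooth_alg_smooth; exact: SAflat.
- move=> x y _ _ xy; rewrite /flat_graph -!hsnorm_sqr_row xy //.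
- exact: is_graph_current_graph.
- by split; [exact: semicalibration_calib|exact: semicalibrated_graph].
split; first by exists 1; split.
have [C C0 hC] := @height_le_energy R m.
(* The estimates give 1 / (2 C r^2); a factor 1 / r > 1 is dropped. *)
have bound (r : R) : 0 < r -> r < m%:R^-1 ->
    (2 * C * r)^-1 <= freqN (@base_plane R m) (graph_current m0) (@calib R m) r.
  move=> r0 rm.
  have r1 : r < 1 by rewrite (lt_le_trans rm) // invf_le1 ?ler1n ?ltr0n.
  have h0 : 0 < freqH (@base_plane R m) (graph_current m0) r by rewrite hH // r0.
  rewrite /freqN ler_pdivlMr //; apply: le_trans (freqGamma_ge m0 hm r0 (ltW rm)).
  rewrite freqHE //.
  set J := \int[_]_(x in _) (_ * _).
  have hr := hC r r0 r1.
  have -> : (m - 1 = (m - 2).+1)%N by rewrite -subSn.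
  have r2 : 0 < r ^+ (m - 2) by rewrite exprn_gt0.
  rewrite exprS.
  set q := r ^+ (m - 2) in r2 *.
  apply: (@le_trans _ _ ((2 * C * r)^-1 * (2 * (r * q)^-1 * (C * r ^+ 3 * J)))).
    rewrite ler_wpM2l ?invr_ge0 ?mulr_ge0 ?(ltW C0) ?(ltW r0) // ler_wpM2l //.
    by rewrite mulr_ge0 // invr_ge0 mulr_ge0 // ltW.
  have -> : (2 * C * r)^-1 * (2 * (r * q)^-1 * (C * r ^+ 3 * J)) = r * (q^-1 * J).
    by field; rewrite !gt_eqF.
  have J0 : 0 <= q^-1 * J.
    rewrite mulr_ge0 ?invr_ge0 ?(ltW r2) //; apply: Rintegral_ge0 => x _.
    by rewrite mulr_ge0 ?energy_density_ge0 // phi_ge0.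
  by rewrite ler_piMl // ltW.
apply/cvgryPge => A.
near=> r.
have r0 : 0 < r by near: r; exact: nbhs_right_gt.
apply: le_trans (bound r r0 _); last first.
  by near: r; apply: nbhs_right_lt; rewrite invr_gt0 ltr0n.
have A0 : 0 < `|A| + 1 by rewrite ltr_wpDl.
apply: (@le_trans _ _ (`|A| + 1)); first by rewrite (le_trans (ler_norm _)) // lerDl.
rewrite -[leLHS]invrK lef_pV2 ?posrE ?invr_gt0 ?mulr_gt0 //.
rewrite -ler_pdivlMl ?mulr_gt0 //; near: r; apply: nbhs_right_le.
by rewrite mulr_gt0 // invr_gt0 // mulr_gt0.
Unshelve. all: by end_near. Qed.
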